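(* Suppose that $\kappa_2\not\equiv\kappa_1-1\pmod e$ and $n\not\equiv\kappa_2-\kappa_1+1\pmod e$. Then $S_{((n-m),(1^m))}$ is an irreducible $\mathscr H_n^\Lambda$-module for all $m\in\{0,\dots,n\}$.
   Context: Let $\mathbb F$ be a field, $e\geqslant 3$ an integer, $I=\mathbb Z/e\mathbb Z$, $n\geqslant 1$ an integer and $\kappa=(\kappa_1,\kappa_2)\in I^2$. For $i,j\in I$ write $i\to j$ if $j=i+1$ and $i\leftarrow j$ if $j=i-1$. The symmetric group $\mathfrak S_n$, with $s_r=(r,r+1)$, acts on $I^n$ by place permutations. Algebra. $\mathscr H_n$ is the unital associative $\mathbb F$-algebra with generators $e(\mathbf i)$ ($\mathbf i\in I^n$), $y_1,\dots,y_n$, $\psi_1,\dots,\psi_{n-1}$ and relations: $e(\mathbf i)e(\mathbf j)=\delta_{\mathbf i,\mathbf j}e(\mathbf i)$; $\sum_{\mathbf i}e(\mathbf i)=1$; $y_re(\mathbf i)=e(\mathbf i)y_r$; $\psi_re(\mathbf i)=e(s_r\mathbf i)\psi_r$; $y_ry_s=y_sy_r$; $\psi_ry_s=y_s\psi_r$ if $s\ne r,r+1$; $\psi_r\psi_s=\psi_s\psi_r$ if $|r-s|>1$; $\psi_ry_{r+1}e(\mathbf i)=(y_r\psi_r+\delta_{i_r,i_{r+1}})e(\mathbf i)$; $y_{r+1}\psi_re(\mathbf i)=(\psi_ry_r+\delta_{i_r,i_{r+1}})e(\mathbf i)$; $\psi_r^2e(\mathbf i)$ equals $0$ if $i_r=i_{r+1}$,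 $(y_{r+1}-y_r)e(\mathbf i)$ if $i_r\to i_{r+1}$, $(y_r-y_{r+1})e(\mathbf i)$ if $i_r\leftarrow i_{r+1}$, and $e(\mathbf i)$ otherwise; $\psi_r\psi_{r+1}\psi_re(\mathbf i)$ equals $(\psi_{r+1}\psi_r\psi_{r+1}+1)e(\mathbf i)$ if $i_{r+2}=i_r\to i_{r+1}$, $(\psi_{r+1}\psi_r\psi_{r+1}-1)e(\mathbf i)$ if $i_{r+2}=i_r\leftarrow i_{r+1}$, and $\psi_{r+1}\psi_r\psi_{r+1}e(\mathbf i)$ otherwise. The cyclotomic algebra $\mathscr H_n^\Lambda$ (level 2) is the quotient of $\mathscr H_n$ by the relations $y_1^{c(i_1)}e(\mathbf i)=0$ for all $\mathbf i\in I^n$, where $c(i)=\#\{j\in\{1,2\}:\kappa_j=i\}$. Specht modules labelled by hook bipartitions. For $0\leqslant m\leqslant n$ put $\mathbf i_{((n-m),(1^m))}=(\kappa_2,\kappa_2-1,\dots,\kappa_2-m+1,\kappa_1,\kappa_1+1,\dots,\kappa_1+n-m-1)\in I^n$. The Specht module $S_{((n-m),(1^m))}$ is the module generated by $z=z_{((n-m),(1^m))}$ subject only to $e(\mathbf i_{((n-m),(1^m))})z=z$, $y_rz=0$ for $1\leqslant r\leqslant n$, and $\psi_rz=0$ for all $r\in\{1,\dots,n-1\}\setminus\{m\}$; it is an $\mathscr H_n^\Lambda$-module. For $1\leqslant a_1<\dots<a_m\leqslant n$ define $v(a_1,\dots,a_m)=(\psi_{a_1-1}\cdots\psi_1)(\psi_{a_2-1}\cdots\psi_2)\cdots(\psi_{a_m-1}\cdots\psi_m)z$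 (indices decreasing in each factor; the factor is $1$ if $a_j=j$). These vectors form an $\mathbb F$-basis (the standard basis) of $S_{((n-m),(1^m))}$. *)

(* Defs.v *)
From HB Require Import structures.
From mathcomp Require Import all_boot all_order all_algebra.
From mathcomp Require Import perm boolp.
From mathcomp Require Import monalg.

Set Implicit Arguments.
Unset Strict Implicit.
Unset Printing Implicit Defensive.

Import GRing.Theory.
Local Open Scope ring_scope.
Local Open Scope quotient_scope.

Section QuotientModule.
Variables (R : pzRingType) (M : lmodType R) (X : M -> Prop).

Inductive submod_gen : M -> Prop :=
  | Submod_mem x of X x : submod_gen x
  | Submod_0 : submod_gen 0
  | Submod_lin a x y of submod_gen x & submod_gen y : submod_gen (a *: x + y).

Definition submod_span : pred M := fun x => `[< submod_gen x >].

Lemma submod_spanP x : reflect (submod_gen x) (x \in submod_span).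
Proof. exact: asboolP. Qed.

Lemma submod_span_closed : submod_closed submod_span.
Proof.
split; first exact/submod_spanP/Submod_0.
by move=> a x y /submod_spanP xX /submod_spanP yX; apply/submod_spanP/Submod_lin.
Qed.

HB.instance Definition _ :=
  GRing.isSubmodClosed.Build R M submod_span
    (GRing.submod_closed_semi submod_span_closed).

Definition submod_span_zmod : zmodClosed M :=
  GRing.ZmodClosed.clone M submod_span _.

Definition quot_module : Type := Quotient.quot submod_span_zmod.

HB.instance Definition _ := GRing.Zmodule.on quot_module.

Definition module_pi (x : M) : quot_module :=
  \pi_(Quotient.quot submod_span_zmod) x.

Definition module_repr (v : quot_module) : M :=
  repr (v : Quotient.quot submod_span_zmod).

Lemma module_reprK : cancel module_repr module_pi.
Proof. exact: reprK. Qed.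

Lemma module_piP x y :
  reflect (module_pi x = module_pi y) (x - y \in submod_span).
Proof. by rewrite (Quotient.idealrBE submod_span_zmod); apply: eqP. Qed.

Fact module_pi_additive : zmod_morphism module_pi.
Proof. exact: (raddfB \pi_(Quotient.quot submod_span_zmod)). Qed.

HB.instance Definition _ :=
  GRing.isZmodMorphism.Build M quot_module module_pi module_pi_additive.

Definition quot_scale (a : R) (v : quot_module) : quot_module :=
  module_pi (a *: module_repr v).

Lemma quot_scaleE a x : quot_scale a (module_pi x) = module_pi (a *: x).
Proof.
apply/module_piP; rewrite -scalerBr rpredZ //.
by apply/module_piP; rewrite module_reprK.
Qed.

Fact quot_scalerA a b v : quot_scale a (quot_scale b v) = quot_scale (a * b) v.
Proof.
by rewrite -[v]module_reprK (quot_scaleE b) !quot_scaleE scalerA.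
Qed.

Fact quot_scale1r : left_id 1 quot_scale.
Proof. by move=> v; rewrite -[v]module_reprK quot_scaleE scale1r. Qed.

Fact quot_scalerDr : right_distributive quot_scale +%R.
Proof.
move=> a u v; rewrite -[u]module_reprK -[v]module_reprK -raddfD.
by rewrite !quot_scaleE scalerDr raddfD.
Qed.

Fact quot_scalerDl v : {morph quot_scale^~ v : a b / a + b}.
Proof.
by move=> a b; rewrite -[v]module_reprK !quot_scaleE scalerDl raddfD.
Qed.

HB.instance Definition _ := GRing.Zmodule_isLmodule.Build R quot_module
  quot_scalerA quot_scale1r quot_scalerDr quot_scalerDl.

Fact module_pi_scalable : scalable module_pi.
Proof. by move=> a x; rewrite -quot_scaleE. Qed.

HB.instance Definition _ :=
  GRing.isScalable.Build R M quot_module *:%R module_pi module_pi_scalable.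
End QuotientModule.

Section QuotientRing.
Variables (R : pzRingType) (X : R -> Prop).

Inductive ideal_gen : R -> Prop :=
  | Ideal_mem x of X x : ideal_gen x
  | Ideal_0 : ideal_gen 0
  | Ideal_add x y of ideal_gen x & ideal_gen y : ideal_gen (x + y)
  | Ideal_mull a x of ideal_gen x : ideal_gen (a * x)
  | Ideal_mulr a x of ideal_gen x : ideal_gen (x * a).

Definition ideal_span : pred R := fun x => `[< ideal_gen x >].

Lemma ideal_spanP x : reflect (ideal_gen x) (x \in ideal_span).
Proof. exact: asboolP. Qed.

Lemma ideal_span_closed : zmod_closed ideal_span.
Proof.
split=> [|x y /ideal_spanP xX /ideal_spanP yX]; apply/ideal_spanP.
  exact: Ideal_0.
by apply: Ideal_add => //; rewrite -mulN1r; apply: Ideal_mull.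
Qed.

HB.instance Definition _ :=
  GRing.isZmodClosed.Build R ideal_span ideal_span_closed.

Lemma ideal_span_mull a x : x \in ideal_span -> a * x \in ideal_span.
Proof. by move=> /ideal_spanP xX; apply/ideal_spanP/Ideal_mull. Qed.

Lemma ideal_span_mulr a x : x \in ideal_span -> x * a \in ideal_span.
Proof. by move=> /ideal_spanP xX; apply/ideal_spanP/Ideal_mulr. Qed.

Definition ideal_span_zmod : zmodClosed R :=
  GRing.ZmodClosed.clone R ideal_span _.

Definition quot_ring : Type := Quotient.quot ideal_span_zmod.

HB.instance Definition _ := GRing.Zmodule.on quot_ring.

Definition ring_pi (x : R) : quot_ring := \pi_(Quotient.quot ideal_span_zmod) x.

Definition ring_repr (v : quot_ring) : R :=
  repr (v : Quotient.quot ideal_span_zmod).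

Lemma ring_reprK : cancel ring_repr ring_pi.
Proof. exact: reprK. Qed.

Lemma ring_piP x y : reflect (ring_pi x = ring_pi y) (x - y \in ideal_span).
Proof. by rewrite (Quotient.idealrBE ideal_span_zmod); apply: eqP. Qed.

Lemma ring_repr_pi x : x - ring_repr (ring_pi x) \in ideal_span.
Proof. by apply/ring_piP; rewrite ring_reprK. Qed.

Fact ring_pi_additive : zmod_morphism ring_pi.
Proof. exact: (raddfB \pi_(Quotient.quot ideal_span_zmod)). Qed.

HB.instance Definition _ :=
  GRing.isZmodMorphism.Build R quot_ring ring_pi ring_pi_additive.

Definition quot_one : quot_ring := ring_pi 1.
Definition quot_mul (x y : quot_ring) : quot_ring :=
  ring_pi (ring_repr x * ring_repr y).

Lemma quot_mulE x y : quot_mul (ring_pi x) (ring_pi y) = ring_pi (x * y).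
Proof.
apply/esym/ring_piP; set x' := ring_repr _; set y' := ring_repr _.
have -> : x * y - x' * y' = (x - x') * y + x' * (y - y').
  by rewrite mulrBl mulrBr addrA subrK.
apply: rpredD; first exact/ideal_span_mulr/ring_repr_pi.
exact/ideal_span_mull/ring_repr_pi.
Qed.

Fact quot_mulA : associative quot_mul.
Proof.
move=> x y z; rewrite -[x]ring_reprK -[y]ring_reprK -[z]ring_reprK.
by rewrite (quot_mulE (ring_repr x) (ring_repr y))
  (quot_mulE (ring_repr y) (ring_repr z)) !quot_mulE mulrA.
Qed.

Fact quot_mul1r : left_id quot_one quot_mul.
Proof. by move=> x; rewrite -[x]ring_reprK quot_mulE mul1r. Qed.

Fact quot_mulr1 : right_id quot_one quot_mul.
Proof. by move=> x; rewrite -[x]ring_reprK quot_mulE mulr1. Qed.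

Fact quot_mulDl : left_distributive quot_mul +%R.
Proof.
move=> x y z; rewrite -[x]ring_reprK -[y]ring_reprK -[z]ring_reprK -raddfD.
by rewrite !quot_mulE mulrDl raddfD.
Qed.

Fact quot_mulDr : right_distributive quot_mul +%R.
Proof.
move=> x y z; rewrite -[x]ring_reprK -[y]ring_reprK -[z]ring_reprK -raddfD.
by rewrite !quot_mulE mulrDr raddfD.
Qed.

HB.instance Definition _ := GRing.Zmodule_isPzRing.Build quot_ring
  quot_mulA quot_mul1r quot_mulr1 quot_mulDl quot_mulDr.

Fact ring_pi_monoid : monoid_morphism ring_pi.
Proof. by split=> // x y; rewrite -quot_mulE. Qed.

HB.instance Definition _ :=
  GRing.isMonoidMorphism.Build R quot_ring ring_pi ring_pi_monoid.

Definition annihilated (M : lmodType R) : Prop :=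
  forall x, X x -> forall v : M, x *: v = 0.

(* When X annihilates M, the action of R on M factors through quot_ring:
   descended is the same additive group M seen as a quot_ring-module. *)
Definition descended (M : lmodType R) of annihilated M : Type := M.

Section Descend.
Variables (M : lmodType R) (annM : annihilated M).
Local Notation MX := (descended annM).

HB.instance Definition _ := GRing.Zmodule.on MX.

Definition descend_scale (a : quot_ring) (v : MX) : MX :=
  ring_repr a *: (v : M).

Lemma ideal_span_annihilates x (v : M) : x \in ideal_span -> x *: v = 0.
Proof.
move=> /ideal_spanP xX.
elim: xX v => {x} [x Xx||x y _ IHx _ IHy|a x _ IH|a x _ IH] v.
- exact: annM.
- exact: scale0r.
- by rewrite scalerDl IHx IHy addr0.
- by rewrite -scalerA IH scaler0.
- by rewrite -scalerA IH.
Qed.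

Lemma descend_scaleE a (v : MX) : descend_scale (ring_pi a) v = a *: (v : M).
Proof.
apply/esym/eqP; rewrite -subr_eq0 -scalerBl ideal_span_annihilates //.
exact: ring_repr_pi.
Qed.

Fact descend_scalerA a b v :
  descend_scale a (descend_scale b v) = descend_scale (a * b) v.
Proof.
rewrite -[a]ring_reprK -[b]ring_reprK -rmorphM.
by rewrite (descend_scaleE (ring_repr b)) !descend_scaleE scalerA.
Qed.

Fact descend_scale1r : left_id 1 descend_scale.
Proof. by move=> v; rewrite -(rmorph1 ring_pi) descend_scaleE scale1r. Qed.

Fact descend_scalerDr : right_distributive descend_scale +%R.
Proof. by move=> a u v; apply: scalerDr. Qed.

Fact descend_scalerDl v : {morph descend_scale^~ v : a b / a + b}.
Proof.
move=> a b; rewrite -[a]ring_reprK -[b]ring_reprK -rmorphD.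
by rewrite !descend_scaleE scalerDl.
Qed.

HB.instance Definition _ := GRing.Zmodule_isLmodule.Build quot_ring MX
  descend_scalerA descend_scale1r descend_scalerDr descend_scalerDl.
End Descend.

End QuotientRing.

Definition irreducible_module (R : pzRingType) (M : lmodType R) : Prop :=
  (exists v : M, v != 0) /\
  forall U : {pred M}, submod_closed U -> U =i pred1 0 \/ U =i predT.

Section KLR.
Variables (F : fieldType) (e n : nat).

(* Positions are numbered from 0: r : 'I_n stands for the position r + 1, and
   r : 'I_n.-1 for the simple transposition exchanging the positions
   lpos r = r and rpos r = r + 1 of 'I_n. *)
Definition lpos (r : 'I_n.-1) : 'I_n := widen_ord (leq_pred n) r.

Fact rpos_subproof (r : 'I_n.-1) : (r.+1 < n)%N.
Proof. by rewrite -ltn_predRL. Qed.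

Definition rpos (r : 'I_n.-1) : 'I_n := Ordinal (rpos_subproof r).

Local Notation residues := {ffun 'I_n -> 'Z_e}.

Definition sact (r : 'I_n.-1) (i : residues) : residues :=
  [ffun k => i (tperm (lpos r) (rpos r) k)].

Definition rarrow (a b : 'Z_e) : bool := b == a + 1.
Definition larrow (a b : 'Z_e) : bool := b == a - 1.

Definition klr_gen : finType := (residues + 'I_n + 'I_n.-1)%type.

(* The free associative unital F-algebra on klr_gen, as the algebra of the free
   monoid on klr_gen. *)
Definition klr_free : nzRingType := {malg F[{fmonom klr_gen}]}.

Definition fe (i : residues) : klr_free := << fmu (inl (inl i) : klr_gen) >>.
Definition fy (r : 'I_n) : klr_free := << fmu (inl (inr r) : klr_gen) >>.
Definition fpsi (r : 'I_n.-1) : klr_free := << fmu (inr r : klr_gen) >>.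

(* klr_rel u v : the relation u = v is imposed. *)
Inductive klr_rel : klr_free -> klr_free -> Prop :=
  | Rel_ee i j :
      klr_rel (fe i * fe j) (if i == j then fe i else 0)
  | Rel_e1 :
      klr_rel (\sum_(i : residues) fe i) 1
  | Rel_ye r i :
      klr_rel (fy r * fe i) (fe i * fy r)
  | Rel_psie r i :
      klr_rel (fpsi r * fe i) (fe (sact r i) * fpsi r)
  | Rel_yy r s :
      klr_rel (fy r * fy s) (fy s * fy r)
  | Rel_psiy r s of s != lpos r & s != rpos r :
      klr_rel (fpsi r * fy s) (fy s * fpsi r)
  | Rel_psipsi (r s : 'I_n.-1) of (r.+1 < s)%N || (s.+1 < r)%N :
      klr_rel (fpsi r * fpsi s) (fpsi s * fpsi r)
  | Rel_psiyr r i :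
      klr_rel (fpsi r * fy (rpos r) * fe i)
              ((fy (lpos r) * fpsi r + (i (lpos r) == i (rpos r))%:R) * fe i)
  | Rel_ypsir r i :
      klr_rel (fy (rpos r) * fpsi r * fe i)
              ((fpsi r * fy (lpos r) + (i (lpos r) == i (rpos r))%:R) * fe i)
  | Rel_psi2 r i :
      klr_rel (fpsi r ^+ 2 * fe i)
        (if i (lpos r) == i (rpos r) then 0
         else if rarrow (i (lpos r)) (i (rpos r))
              then (fy (rpos r) - fy (lpos r)) * fe i
         else if larrow (i (lpos r)) (i (rpos r))
              then (fy (lpos r) - fy (rpos r)) * fe i
         else fe i)
  | Rel_braid (r s : 'I_n.-1) i of s = r.+1 :> nat :
      klr_rel (fpsi r * fpsi s * fpsi r * fe i)
        (if (i (rpos s) == i (lpos r)) && rarrow (i (lpos r)) (i (rpos r))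
         then (fpsi s * fpsi r * fpsi s + 1) * fe i
         else if (i (rpos s) == i (lpos r)) && larrow (i (lpos r)) (i (rpos r))
         then (fpsi s * fpsi r * fpsi s - 1) * fe i
         else fpsi s * fpsi r * fpsi s * fe i).

Definition klr_relator (x : klr_free) : Prop :=
  exists u v, klr_rel u v /\ x = u - v.

(* The scalar k of F acts on klr-modules through the image of k%:MP, so modules
   over the F-algebra klr are modules over the underlying ring. *)
Definition klr : pzRingType := quot_ring klr_relator.

Definition ke (i : residues) : klr := ring_pi klr_relator (fe i).
Definition ky (r : 'I_n) : klr := ring_pi klr_relator (fy r).
Definition kpsi (r : 'I_n.-1) : klr := ring_pi klr_relator (fpsi r).

Variables kappa1 kappa2 : 'Z_e.

Definition kappa_mult (a : 'Z_e) : nat := (kappa1 == a) + (kappa2 == a).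

Inductive cyclotomic_relator : klr -> Prop :=
  | Cyclotomic (r : 'I_n) (i : residues) of r = 0%N :> nat :
      cyclotomic_relator (ky r ^+ kappa_mult (i r) * ke i).

Definition cyclotomic_klr : pzRingType := quot_ring cyclotomic_relator.

Variable m : nat.

Definition hook_residues : residues :=
  [ffun k : 'I_n => if (k < m)%N then kappa2 - k%:R else kappa1 + (k - m)%:R].

(* Elements of klr that annihilate the generator; the last constructor excludes
   the m-th transposition, which has index m - 1 here. *)
Inductive specht_relator : klr^o -> Prop :=
  | Specht_e : specht_relator (ke hook_residues - 1)
  | Specht_y r : specht_relator (ky r)
  | Specht_psi (r : 'I_n.-1) of r.+1 <> m : specht_relator (kpsi r).

Definition specht : lmodType klr := quot_module specht_relator.

End KLR.

Arguments cyclotomic_relator F {e} n kappa1 kappa2 _.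
Arguments cyclotomic_klr F {e} n kappa1 kappa2.
Arguments specht_relator F {e} n kappa1 kappa2 m _.
Arguments specht F {e} n kappa1 kappa2 m.

(* Main.v *)
(** Encode [v(a_1, ..., a_m)] by the set of the [a_j]. The relations determine how
    [psi_r] and [y_r] act on these vectors: each vector goes to zero or, up to
    sign, to another one, by a rule which only involves the positions around [r]
    and the residue of [r - (kappa2 - kappa1 + 1)] modulo [e]. These rules define a
    representation on the space [V] spanned by all subsets. In the Specht module
    the [v(a_1, ..., a_m)] form a spanning set, by induction on the length, and
    the map to [V] sends them to distinct basis vectors; hence it is injective.

    Given a nonzero vector of [V], one isolates a single basis vector: distinct
    residue sequences are separated by the idempotents, and two subsets with the
    same residues first differ in an adjacent pair [r, r + 1] with
    [r = kappa2 - kappa1 + 1] modulo [e], where [y_r] kills one of them only; the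
    pair fits in [1, n] because [n] is not such an [r]. From a single basis vector
    the generators lead down to [z]; here [r = 0] must not be congruent to
    [kappa2 - kappa1 + 1] either. *)

From HB Require Import structures.
Require Import Defs.
From mathcomp Require Import all_boot all_order all_algebra.
From mathcomp Require Import finmap perm boolp monalg zify ring.

Set Implicit Arguments.
Unset Strict Implicit.
Unset Printing Implicit Defensive.

Import GRing.Theory.
Local Open Scope ring_scope.

(** * Modules over the free algebra *)

(** A module given by generators and relations could collapse, so an explicit model has to bound it
    from below. The rules of the model can be local for the following reason. Let N count the
    occupied positions before r, the dummy included. If exactly one of r, r + 1 is occupied, the
    occupied one has residue kappa2 + 1 - N and the empty one kappa1 + r - N: their difference
    kappa2 - kappa1 + 1 - r no longer involves N. Neighbours that are both occupied or both empty
    always differ by 1. So every case distinction in the relations depends only on the class of r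
    and on the occupation nearby. At class 0 an occupied and an empty neighbour can be exchanged
    without changing the residue sequence, which is why a residue sequence can belong to several
    vectors and why some y act nontrivially. All coefficients in the rules are signs and all classes
    other than 0, 1, -1 behave alike, so one finite computation proves the relations over every
    field, for all e >= 3 and all n. The cyclotomic relations are also checked on configurations,
    and pulled back to the Specht module along the injection. *)

Section LinearExtension.
Variables (F : fieldType) (K : choiceType) (M : lmodType F).

Definition lext (f : K -> M) (g : {malg F[K]}) : M :=
  \sum_(k <- msupp g) g@_k *: f k.

Lemma lextEw f (g : {malg F[K]}) (d : {fset K}) :
  {subset msupp g <= d} -> lext f g = \sum_(k <- d) g@_k *: f k.
Proof.
move=> /fsubsetP sgd; rewrite /lext (big_fset_incl _ sgd) //= => k kd kg.
by rewrite mcoeff_outdom ?scale0r.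
Qed.

Fact lext_linear f : linear (lext f).
Proof.
move=> a x y; pose d := (msupp x `|` msupp y)%fset.
rewrite (@lextEw _ x d) => [|k]; last by rewrite in_fsetU => ->.
rewrite (@lextEw _ y d) => [|k]; last by rewrite in_fsetU orbC => ->.
rewrite (@lextEw _ (a *: x + y) d) => [|k].
  rewrite scaler_sumr -big_split; apply: eq_bigr => k _ /=.
  by rewrite mcoeffD mcoeffZ scalerDl scalerA.
move/(fsubsetP (msuppD_le _ _)); rewrite !in_fsetU.
by case/orP=> [/(fsubsetP (msuppZ_le _ _))|] ->; rewrite ?orbT.
Qed.

HB.instance Definition _ f :=
  GRing.isLinear.Build F {malg F[K]} M *:%R (lext f) (lext_linear f).

Lemma lextU f k : lext f << k >> = f k.
Proof.
rewrite (@lextEw f _ [fset k]%fset) => [|j]; last exact/fsubsetP/msuppU_le.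
by rewrite big_seq_fset1 mcoeffUU scale1r.
Qed.
End LinearExtension.

Lemma malg_ind (F : fieldType) (K : choiceType) (P : {malg F[K]} -> Prop) :
  P 0 -> (forall a k g, P g -> P (a *: << k >> + g)) -> forall g, P g.
Proof.
move=> P0 PD g; rewrite (monalgE g).
elim: (enum_fset (msupp g)) => [|k s IH].
  by rewrite big_nil.
have E : << g@_k *g k >> = g@_k *: << k >> :> {malg F[K]}; last first.
  by rewrite big_cons E; apply: PD.
by apply/malgP => j; rewrite mcoeffZ !mcoeffU mulrnAr mulr1.
Qed.

Lemma lext_unique (F : fieldType) (K : choiceType) (M : lmodType F)
    (f h : {linear {malg F[K]} -> M}) :
  (forall k, f << k >> = h << k >>) -> f =1 h.
Proof.
move=> fh; elim/malg_ind => [|a k g IH]; first by rewrite !raddf0.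
by rewrite !linearP fh IH.
Qed.

Section FreeAction.
Variables (F : fieldType) (G : choiceType) (V : lmodType F).
Variable act : G -> {linear V -> V}.
Local Notation free := {malg F[{fmonom G}]}.

(** A copy of [V] tagged by [act], so that the module structure over the free algebra can depend on
    [act]. *)
Definition free_mod of (G -> {linear V -> V}) : Type := V.
Local Notation VG := (free_mod act).

HB.instance Definition _ := GRing.Zmodule.on VG.

Definition word_act (w : {fmonom G}) (v : V) : V :=
  foldr (fun g => act g : V -> V) v w.

Definition free_scale (x : free) (v : VG) : VG :=
  lext (fun w => word_act w v) x.

Fact word_act_linear w : linear (word_act w).
Proof.
rewrite /word_act => a u v; elim: (w : seq G) => //= g s ->; exact: linearP.
Qed.
HB.instance Definition _ w :=
  GRing.isLinear.Build F V V *:%R (word_act w) (word_act_linear w).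

Lemma free_scaleU w v : free_scale << w >> v = word_act w v.
Proof. exact: lextU. Qed.

Fact free_scale_linear x : linear (free_scale x : V -> V).
Proof.
move=> a u v; rewrite /free_scale /lext scaler_sumr -big_split.
by apply: eq_bigr => k _; rewrite linearP scalerDr !scalerA mulrC.
Qed.

Lemma free_scale_Pl a x y v :
  free_scale (a *: x + y) v = a *: (free_scale x v : V) + free_scale y v.
Proof. exact: linearP. Qed.

Lemma free_scale_0l v : free_scale 0 v = 0.
Proof. exact: raddf0. Qed.

Lemma free_scale_Zl a x v : free_scale (a *: x) v = a *: (free_scale x v : V).
Proof. exact: linearZ. Qed.

Fact free_scale_Dl v : {morph free_scale^~ v : x y / x + y}.
Proof. by move=> x y; apply: raddfD. Qed.

Fact free_scale_Dr : right_distributive free_scale +%R.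
Proof.
by move=> x u v; have := free_scale_linear x 1 u v; rewrite !scale1r.
Qed.

Fact free_scale_1l : left_id 1 free_scale.
Proof. by move=> v; rewrite free_scaleU /word_act fm1. Qed.

Fact free_scaleA x y v : free_scale x (free_scale y v) = free_scale (x * y) v.
Proof.
elim/malg_ind: x => [|a k x IH]; first by rewrite mul0r !free_scale_0l.
rewrite mulrDl free_scale_Pl free_scale_Dl {}IH; congr (_ + _).
rewrite -mul_malgC -mulrA mul_malgC free_scale_Zl; congr (_ *: _).
elim/malg_ind: y => [|b l y IH].
  by rewrite mulr0 !free_scale_0l free_scaleU linear0.
rewrite mulrDr free_scale_Pl free_scale_Dl free_scale_Dr {}IH; congr (_ + _).
have -> : << k >> * (b *: << l >>) = b *: << mmul k l >> :> free.
  rewrite -!mul_malgC mulrA !malgM_def !fgmulUU !mul1r !mulr1.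
  by rewrite mulm1 mul1m.
rewrite free_scale_Zl !free_scaleU linearZ /=; congr (_ *: _).
by rewrite /word_act fmM foldr_cat.
Qed.

HB.instance Definition _ := GRing.Zmodule_isLmodule.Build free VG
  free_scaleA free_scale_1l free_scale_Dr free_scale_Dl.

Lemma free_actU (g : G) (v : VG) :
  (<< fmu g >> : free) *: v = act g v.
Proof. by rewrite [LHS]free_scaleU /word_act fmU. Qed.

Lemma free_actC (a : F) (v : VG) : (a%:MP : free) *: v = a *: (v : V).
Proof.
rewrite -[a%:MP]mulr1 mul_malgC [LHS]/(free_scale _ _) /free_scale linearZ /=.
by rewrite lextU /word_act fm1.
Qed.
End FreeAction.

(** * The operators on configurations and their relations *)

(* A configuration stands for the basis vector [v(a_1, ..., a_m)] of the Specht
   module: [A p] says whether [p] is one of the [a_j]. Positions are numbered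
   from 1; position 0 is a dummy, always occupied in the end, which spares the
   local rules below a special case at the left boundary. *)
Definition config := nat -> bool.

(* The type of a position [p] is the class of [p - (kappa2 - kappa1 + 1)] modulo
   [e]: [Tz], [Tp], [Tm] stand for 0, 1, -1, and [Tg] for the other classes. *)
Variant ptype := Tz | Tp | Tm | Tg.

(** [Tp] is followed by [Tm] exactly when e = 3, and the successor of [Tg] depends on the distance
    to the class -1. Listing both possibilities lets one enumeration serve every e >= 3. *)
Definition tnext (t : ptype) : seq ptype :=
  match t with Tm => [:: Tz] | Tz => [:: Tp] | _ => [:: Tm; Tg] end.

Definition is_tz t := if t is Tz then true else false.
Definition is_tp t := if t is Tp then true else false.
Definition is_tm t := if t is Tm then true else false.

(* [psi_move] and [y_move] describe the action of [psi_r] and [y_r] on a basis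
   vector in terms of the occupation of the positions [r - 1], [r], ... and of
   the types [t] of [r - 1] (for [y]) and of [r]. [Some (s, i, j)] means that the
   entry at [r - 1 + i] moves to [r - 1 + j] and that the sign is [(-1)^s]; [None]
   means that the result is zero. The rules are what the Specht relations force
   on the standard basis. *)
Definition psi_move t (a b c d : bool) : option (bool * nat * nat) :=
  if b && ~~ c then Some (false, 1, 2)%N else
  match t with
  | Tp => if c && ~~ a then Some (~~ b, 2, 0)%N else None
  | Tm => if ~~ b && d then Some (~~ c, 3, 1)%N else None
  | Tg => if ~~ b && c then Some (false, 2, 1)%N else None
  | Tz => None
  end.

Definition y_move t u (a b c : bool) : option (bool * nat * nat) :=
  if [&& is_tz u, ~~ b & c] then Some (true, 2, 1)%N else
  if [&& is_tz t, b & ~~ a] then Some (false, 1, 0)%N else None.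

Definition upd (A : config) q b : config := fun p => if p == q then b else A p.
Definition jump (A : config) i j : config := upd (upd A i false) j true.

(* A window is the restriction of a configuration to a list of positions, and
   [wop] names an operator by the slot of the window on which it is centred. The
   relations involve few positions, so that they can be checked by computation
   on all windows and all possible sequences of types. *)
Inductive wop := Psi of nat | Y of nat.

Definition wjump o (w : seq bool) (x : option (bool * nat * nat)) :
    seq (bool * seq bool) :=
  if x is Some (s, i, j)
  then [:: (s, set_nth false (set_nth false w (o + i)%N false) (o + j)%N true)]
  else [::].

Definition wact1 (ts : seq ptype) (g : wop) (w : seq bool) :=
  match g with
  | Psi o => wjump o w (psi_move (nth Tg ts o.+1) (nth false w o)
       (nth false w o.+1) (nth false w o.+2) (nth false w o.+3))
  | Y o => wjump o w (y_move (nth Tg ts o) (nth Tg ts o.+1) (nth false w o)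
       (nth false w o.+1) (nth false w o.+2))
  end.

Definition wsign (s : bool) (l : seq (bool * seq bool)) :=
  [seq (s (+) x.1, x.2) | x <- l].

Definition wact ts g (l : seq (bool * seq bool)) :=
  flatten [seq wsign x.1 (wact1 ts g x.2) | x <- l].

Definition wword ts (gs : seq wop) w := foldr (wact ts) [:: (false, w)] gs.

Definition wcomb ts (c : seq (bool * seq wop)) w :=
  flatten [seq wsign x.1 (wword ts x.2 w) | x <- c].

(** Each term is paired with its opposite, so success means a zero sum in every characteristic. The
    argument [n] is fuel bounding the length. *)
Fixpoint cancels n (l : seq (bool * seq bool)) :=
  if l is x :: l' then
    if n is n'.+1 then
      let x' := (~~ x.1, x.2) in
      (x' \in l') && cancels n' (rem x' l')
    else false
  else true.

Definition vanishes ts c w := let l := wcomb ts c w in cancels (size l) l.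

Fixpoint type_seqs L t : seq (seq ptype) :=
  if L is L'.+1
  then [seq t :: ts | ts <- flatten [seq type_seqs L' u | u <- tnext t]]
  else [:: [::]].

Definition all_types := [:: Tz; Tp; Tm; Tg].
Definition all_type_seqs L := flatten [seq type_seqs L t | t <- all_types].

Fixpoint bool_seqs L : seq (seq bool) :=
  if L is L'.+1
  then [seq b :: w | b <- [:: true; false], w <- bool_seqs L'] else [:: [::]].

Definition check_windows L (P : seq ptype -> seq bool -> bool) :=
  all (fun ts => all (P ts) (bool_seqs L)) (all_type_seqs L).
(** For two windows far apart: the types on one do not constrain those on the other, so all pairs of
    type sequences are tried. *)
Definition check_window_pairs L M (P : seq ptype -> seq bool -> bool) :=
  all (fun ts => all (fun us => all (P (ts ++ us)) (bool_seqs (L + M))) (all_type_seqs M))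
   (all_type_seqs L).

Definition commutes g h ts w :=
  vanishes ts [:: (false, [:: g; h]); (true, [:: h; g])] w.

(* [eqr], [rar], [lar] decide whether the residues at two adjacent positions, the
   first one of type [t], are equal or related by an arrow; [eqr2] compares the
   residues two positions apart. *)
Definition eqr t (b c : bool) := is_tz t && (b != c).
Definition rar t b c :=
  match b, c with true, true => false | false, false => true
  | true, false => is_tp t | false, true => is_tm t end.
Definition lar t b c :=
  match b, c with true, true => true | false, false => false
  | true, false => is_tm t | false, true => is_tp t end.
Definition eqr2 t (b c d : bool) :=
  (b != d) && (if b == c then is_tz t else is_tm t).

Definition delta (b : bool) : seq (bool * seq wop) :=
  if b then [:: (true, [::])] else [::].

Definition psiy_comb t b c :=
  [:: (false, [:: Psi 0; Y 1]); (true, [:: Y 0; Psi 0])] ++ delta (eqr t b c).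
Definition ypsi_comb t b c :=
  [:: (false, [:: Y 1; Psi 0]); (true, [:: Psi 0; Y 0])] ++ delta (eqr t b c).
Definition psi2_comb t b c :=
  (false, [:: Psi 0; Psi 0]) ::
  if eqr t b c then [::]
  else if rar t b c then [:: (true, [:: Y 1]); (false, [:: Y 0])]
  else if lar t b c then [:: (true, [:: Y 0]); (false, [:: Y 1])]
  else [:: (true, [::])].
Definition braid_comb t b c d :=
  [:: (false, [:: Psi 0; Psi 1; Psi 0]); (true, [:: Psi 1; Psi 0; Psi 1])] ++
  if eqr2 t b c d && rar t b c then [:: (true, [::])]
  else if eqr2 t b c d && lar t b c then [:: (false, [::])] else [::].

(** The window of a relation centred at r starts at r - 1, so the slots 1, 2, 3 hold the positions
    r, r + 1, r + 2. *)
Definition vanishes_at (P : ptype -> bool -> bool -> bool -> seq (bool * seq wop)) ts w :=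
  vanishes ts (P (nth Tg ts 1) (nth false w 1) (nth false w 2) (nth false w 3)) w.

Lemma psi_move_lt t a b c d :
  if psi_move t a b c d is Some (_, i, j) then (i < 4)%N && (j < 4)%N else true.
Proof. by case: t; case: a; case: b; case: c; case: d. Qed.

Lemma y_move_lt t u a b c :
  if y_move t u a b c is Some (_, i, j) then (i < 3)%N && (j < 3)%N else true.
Proof. by case: t; case: u; case: a; case: b; case: c. Qed.

Lemma all_flatten (S : Type) (P : pred S) (ss : seq (seq S)) :
  all P (flatten ss) = all (all P) ss.
Proof. by elim: ss => //= s ss <-; rewrite all_cat. Qed.

(** * Soundness of the computation on windows *)

Section Window.
Variables (F : fieldType) (T : nat -> ptype).
Hypothesis hT : forall p (P : pred ptype), all P (tnext (T p)) -> P (T p.+1).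
Local Notation V := {malg F[config]}.

Definition move_vec (A : config) k (x : option (bool * nat * nat)) : V :=
  if x is Some (s, i, j) then (-1) ^+ s *: << jump A (k + i)%N (k + j)%N >> else 0.

(* The index [k] stands for the position [k + 1]. *)
Definition psi_vec k (A : config) : V :=
  move_vec A k (psi_move (T k.+1) (A k) (A k.+1) (A k.+2) (A k.+3)).
Definition y_vec k (A : config) : V :=
  move_vec A k (y_move (T k) (T k.+1) (A k) (A k.+1) (A k.+2)).

Definition psi_op k : {linear V -> V} := lext (psi_vec k).
Definition y_op k : {linear V -> V} := lext (y_vec k).

Definition fill (A : config) (ps : seq nat) (w : seq bool) : config :=
  fun q => if q \in ps then nth false w (index q ps) else A q.

Lemma fill_nth A ps w i : uniq ps -> (i < size ps)%N ->
  fill A ps w (nth 0%N ps i) = nth false w i.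
Proof. by move=> ups ip; rewrite /fill mem_nth // index_uniq. Qed.

Lemma fill_set A ps w i b : uniq ps -> (i < size ps)%N ->
  fill A ps (set_nth false w i b) = upd (fill A ps w) (nth 0%N ps i) b.
Proof.
move=> ups ip; apply/funext => q; rewrite /upd /fill nth_set_nth /=.
case: (boolP (q \in ps)) => [qp|qp].
  by rewrite -(nth_uniq 0%N _ ip ups) ?index_mem // nth_index.
by case: eqP qp => // ->; rewrite mem_nth.
Qed.

Lemma fill_id A ps : fill A ps (map A ps) = A.
Proof.
apply/funext => q; rewrite /fill; case: ifP => // qp.
by rewrite (nth_map 0%N) ?index_mem // nth_index.
Qed.

Definition interp A ps (l : seq (bool * seq bool)) : V :=
  \sum_(x <- l) (-1) ^+ x.1 *: << fill A ps x.2 >>.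

Lemma interp_nil A ps : interp A ps [::] = 0.
Proof. exact: big_nil. Qed.
Lemma interp_cons A ps x l :
  interp A ps (x :: l) = (-1) ^+ x.1 *: << fill A ps x.2 >> + interp A ps l.
Proof. exact: big_cons. Qed.
Lemma interp_cat A ps l1 l2 :
  interp A ps (l1 ++ l2) = interp A ps l1 + interp A ps l2.
Proof. exact: big_cat. Qed.

Lemma interp_sign A ps s l : interp A ps (wsign s l) = (-1) ^+ s *: interp A ps l.
Proof.
rewrite /interp big_map scaler_sumr; apply: eq_bigr => x _ /=.
by rewrite scalerA signr_addb.
Qed.

Lemma interp1 A ps : (<< A >> : V) = interp A ps [:: (false, map A ps)].
Proof. by rewrite interp_cons interp_nil addr0 scale1r fill_id. Qed.

Lemma interp_cancels A ps n l : cancels n l -> interp A ps l = 0.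
Proof.
elim: n l => [|n IH] [|x l] //=; rewrite ?interp_nil // => /andP[xl /IH E].
rewrite interp_cons {1}/interp (big_rem _ xl) /= -/(interp A ps _) E addr0.
by rewrite signrN scaleNr subrr.
Qed.

Definition slot ps k o L :=
  (o + L <= size ps)%N && all (fun j => nth 0%N ps (o + j) == (k + j)%N) (iota 0 L).

Definition gop (g : wop) : {linear V -> V} :=
  match g with Psi k => psi_op k | Y k => y_op k end.
Definition gslot ps (g : wop) :=
  match g with
  | Psi o => slot ps (nth 0%N ps o) o 4
  | Y o => slot ps (nth 0%N ps o) o 3
  end.
Definition gplace (ps : seq nat) (g : wop) :=
  match g with
  | Psi o => Psi (nth 0%N ps o)
  | Y o => Y (nth 0%N ps o)
  end.

Lemma slotP ps k o L j : slot ps k o L -> (j < L)%N ->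
  nth 0%N ps (o + j) = (k + j)%N /\ (o + j < size ps)%N.
Proof.
case/andP=> oL /allP sl jL; split; last by apply: leq_trans oL; rewrite ltn_add2l.
by apply/eqP/sl; rewrite mem_iota.
Qed.

Lemma interp_wjump A ps k o L w x : uniq ps -> slot ps k o L ->
  (if x is Some (_, i, j) then (i < L)%N && (j < L)%N else true) ->
  interp A ps (wjump o w x) = move_vec (fill A ps w) k x.
Proof.
move=> ups sl; case: x => [[[s i] j]|] /=; last by rewrite interp_nil.
case/andP=> /(slotP sl)[ei si] /(slotP sl)[ej sj].
by rewrite interp_cons interp_nil addr0 /= !fill_set // ei ej.
Qed.

(** The bridge between computation and algebra: an operator whose slots lie in the window reads and
    changes nothing outside it, so its effect is computed on [w] while the rest of [A] stays
    arbitrary. *)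
Lemma interp_wact1 A ps g w : uniq ps -> gslot ps g ->
  gop (gplace ps g) << fill A ps w >> = interp A ps (wact1 (map T ps) g w).
Proof.
move=> ups; case: g => o /= sl.
- have := slotP sl (isT : (0 < 4)%N); have := slotP sl (isT : (1 < 4)%N).
  have := slotP sl (isT : (2 < 4)%N); have := slotP sl (isT : (3 < 4)%N).
  rewrite ?addnS ?addn0 => -[e3 s3] [e2 s2] [e1 s1] [e0 s0].
  rewrite lextU /psi_vec -e3 -e2 -e1 !fill_nth //.
  rewrite (interp_wjump _ _ ups sl) ?(nth_map 0%N) //.
  exact: psi_move_lt.
- have := slotP sl (isT : (0 < 3)%N); have := slotP sl (isT : (1 < 3)%N).
  have := slotP sl (isT : (2 < 3)%N).
  rewrite ?addnS ?addn0 => -[e2 s2] [e1 s1] [e0 s0].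
  rewrite lextU /y_vec -e2 -e1 !fill_nth //.
  rewrite (interp_wjump _ _ ups sl) ?(nth_map 0%N) //.
  exact: y_move_lt.
Qed.

Lemma interp_wact A ps g l : uniq ps -> gslot ps g ->
  gop (gplace ps g) (interp A ps l) = interp A ps (wact (map T ps) g l).
Proof.
move=> ups sl; elim: l => [|x l IH]; first by rewrite interp_nil linear0.
rewrite interp_cons linearD linearZ /= IH [in RHS]/wact /= interp_cat interp_sign.
by rewrite interp_wact1.
Qed.

Definition word_op (gs : seq wop) (v : V) : V := foldr (fun g => gop g : V -> V) v gs.
Definition comb_op (c : seq (bool * seq wop)) (v : V) : V :=
  \sum_(x <- c) (-1) ^+ x.1 *: word_op x.2 v.

Definition pcomb ps (c : seq (bool * seq wop)) :=
  [seq (x.1, map (gplace ps) x.2) | x <- c].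
Definition cslot ps (c : seq (bool * seq wop)) := all (fun x => all (gslot ps) x.2) c.

Lemma interp_word A ps gs : uniq ps -> all (gslot ps) gs ->
  word_op (map (gplace ps) gs) << A >> =
  interp A ps (wword (map T ps) gs (map A ps)).
Proof.
move=> ups; elim: gs => [|g gs IHg] /=; first by rewrite -interp1.
by case/andP=> sg /IHg ->; rewrite interp_wact.
Qed.

Lemma vanishesP A ps c : uniq ps -> cslot ps c ->
  vanishes (map T ps) c (map A ps) -> comb_op (pcomb ps c) << A >> = 0.
Proof.
move=> ups sl /(@interp_cancels A ps) <-; rewrite /comb_op big_map /wcomb.
elim: c sl => [|x c IH] /=; first by rewrite big_nil interp_nil.
case/andP=> sx /IH {}IH; rewrite big_cons IH interp_cat interp_sign.
by rewrite interp_word.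
Qed.

(** The hypothesis [hT] says that [T p.+1] occurs in [tnext (T p)]; its form with a predicate is
    what the induction on the window length consumes. *)
Lemma type_seqsP L k (P : pred (seq ptype)) :
  all P (type_seqs L (T k)) -> P (map T (iota k L)).
Proof.
elim: L k P => [|L IH] k P /=; first by case/andP.
rewrite all_map => allP; apply: (IH k.+1 (fun l => P (T k :: l))).
apply: (@hT k (fun t => all (fun l => P (T k :: l)) (type_seqs L t))).
by move: allP; rewrite all_flatten all_map.
Qed.

Lemma all_type_seqsP L k (P : pred (seq ptype)) :
  all P (all_type_seqs L) -> P (map T (iota k L)).
Proof.
move=> allP; apply: type_seqsP; move: allP.
by rewrite all_flatten /= => /and5P[? ? ? ? _]; case: (T k).
Qed.

Lemma bool_seqsP L (P : pred (seq bool)) w :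
  size w = L -> all P (bool_seqs L) -> P w.
Proof.
elim: w L P => [|b w IH] [|L] P //=; first by move=> _; case/andP.
case=> sw; rewrite !all_cat !all_map => /and3P[aT aF _].
by apply: (IH L (fun l => P (b :: l))) => //; case: b.
Qed.

Lemma check_windowsP L P A k : check_windows L P ->
  P (map T (iota k L)) (map A (iota k L)).
Proof.
move/(@all_type_seqsP L k)/bool_seqsP; apply.
by rewrite size_map size_iota.
Qed.

Lemma check_window_pairsP L M P A k l : check_window_pairs L M P ->
  P (map T (iota k L ++ iota l M)) (map A (iota k L ++ iota l M)).
Proof.
move/(@all_type_seqsP L k)/(@all_type_seqsP M l)/bool_seqsP; rewrite map_cat; apply.
by rewrite size_map size_cat !size_iota.
Qed.
End Window.

Section SignedSums.
Variables (R : nzRingType) (M : lmodType R).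
Implicit Types a b c : M.

Lemma signed_eq0 a : (-1) ^+ false *: a + 0 = 0 -> a = 0.
Proof. by rewrite scale1r addr0. Qed.

Lemma signed_eq a b : (-1) ^+ false *: a + ((-1) ^+ true *: b + 0) = 0 -> a = b.
Proof. by rewrite scale1r scaleN1r addr0; apply: subr0_eq. Qed.

Lemma signed_eqD a b c :
  (-1) ^+ false *: a + ((-1) ^+ true *: b + ((-1) ^+ true *: c + 0)) = 0 ->
  a = b + c.
Proof.
by rewrite scale1r !scaleN1r addr0 => H; apply: subr0_eq; rewrite opprD.
Qed.

Lemma signed_eqB a b c :
  (-1) ^+ false *: a + ((-1) ^+ true *: b + ((-1) ^+ false *: c + 0)) = 0 ->
  a = b - c.
Proof.
rewrite !scale1r !scaleN1r addr0 => H; apply: subr0_eq.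
by rewrite opprB [c - b]addrC.
Qed.
End SignedSums.

(** * The defining relations on basis vectors *)

Section FockRelations.
Variables (F : fieldType) (T : nat -> ptype).
Hypothesis hT : forall p (P : pred ptype), all P (tnext (T p)) -> P (T p.+1).
Local Notation V := {malg F[config]}.
Local Notation psi := (psi_op F T).
Local Notation y := (y_op F T).

Lemma slot_iota k L o M : (o + M <= L)%N ->
  slot (iota k L) (nth 0%N (iota k L) o) o M.
Proof.
move=> oL; rewrite /slot size_iota oL; apply/allP => j.
rewrite mem_iota => /= jM; rewrite !nth_iota; lia.
Qed.

Lemma slot_catl k l L N o M : (o + M <= L)%N ->
  slot (iota k L ++ iota l N) (nth 0%N (iota k L ++ iota l N) o) o M.
Proof.
move=> oL; rewrite /slot size_cat !size_iota; apply/andP; split; first lia.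
apply/allP => j; rewrite mem_iota => /= jM; rewrite !nth_cat !size_iota.
rewrite !ifT ?nth_iota; lia.
Qed.

Lemma slot_catr k l L N o M : (L <= o)%N -> (o + M <= L + N)%N ->
  slot (iota k L ++ iota l N) (nth 0%N (iota k L ++ iota l N) o) o M.
Proof.
move=> Lo oL; rewrite /slot size_cat !size_iota; apply/andP; split; first lia.
apply/allP => j; rewrite mem_iota => /= jM; rewrite !nth_cat !size_iota.
rewrite !ifF ?nth_iota; lia.
Qed.

Lemma op_ext (f h : {linear V -> V}) : (forall A, f << A >> = h << A >>) -> f =1 h.
Proof. exact: lext_unique. Qed.

Lemma commutesP ps g h : uniq ps -> gslot ps g -> gslot ps h ->
  (forall A, commutes g h (map T ps) (map A ps)) ->
  forall v : V, gop F T (gplace ps g) (gop F T (gplace ps h) v) =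
            gop F T (gplace ps h) (gop F T (gplace ps g) v).
Proof.
move=> ups sg sh com v.
apply: (@op_ext (gop F T (gplace ps g) \o gop F T (gplace ps h))
                (gop F T (gplace ps h) \o gop F T (gplace ps g))) => A /=.
have : comb_op (F := F) T (pcomb ps [:: (false, [:: g; h]); (true, [:: h; g])])
         << A >> = 0.
  by apply: vanishesP => //; [rewrite /cslot /= sg sh | exact: com].
rewrite /comb_op /= !big_cons big_nil /= addr0 scale1r scaleN1r.
exact: subr0_eq.
Qed.

Lemma uniq_chunks k l L M : (k + L <= l)%N || (l + M <= k)%N ->
  uniq (iota k L ++ iota l M).
Proof.
move=> kl; rewrite cat_uniq !iota_uniq /= andbT; apply/hasPn => j.
rewrite !mem_iota; lia.
Qed.

Lemma commute_iota k L g h : gslot (iota k L) g -> gslot (iota k L) h ->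
  check_windows L (commutes g h) ->
  forall v : V, gop F T (gplace (iota k L) g) (gop F T (gplace (iota k L) h) v) =
            gop F T (gplace (iota k L) h) (gop F T (gplace (iota k L) g) v).
Proof.
move=> sg sh c; apply: commutesP => //; first exact: iota_uniq.
by move=> A; apply: check_windowsP.
Qed.

Lemma commute_chunks k l L M g h (ps := iota k L ++ iota l M) :
  (k + L <= l)%N || (l + M <= k)%N -> gslot ps g -> gslot ps h ->
  check_window_pairs L M (commutes g h) ->
  forall v : V, gop F T (gplace ps g) (gop F T (gplace ps h) v) =
            gop F T (gplace ps h) (gop F T (gplace ps g) v).
Proof.
move=> kl sg sh c; apply: commutesP => //; first exact: uniq_chunks.
by move=> A; apply: check_window_pairsP.
Qed.

Lemma psi_opC k l v : (k.+1 < l)%N -> psi k (psi l v) = psi l (psi k v).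
Proof.
(* [psi k] reads the positions from k to k + 3, so the two windows overlap only for l = k + 2 and l
   = k + 3; beyond that they are disjoint. *)
move=> kl; have [->|l2] := eqVneq l k.+2.
  by apply: (@commute_iota k 6 (Psi 0) (Psi 2));
    [exact: slot_iota | exact: slot_iota | vm_compute].
have [->|l3] := eqVneq l k.+3.
  by apply: (@commute_iota k 7 (Psi 0) (Psi 3));
    [exact: slot_iota | exact: slot_iota | vm_compute].
apply: (@commute_chunks k l 4 4 (Psi 0) (Psi 4)).
- lia.
- exact: slot_catl.
- exact: slot_catr.
- by vm_compute.
Qed.

Lemma y_opC k l v : y k (y l v) = y l (y k v).
Proof.
wlog kl : k l / (k < l)%N => [IH|].
  have [lt|lt|-> //] := ltngtP k l; [exact: IH | exact/esym/IH].
have [->|l2] := eqVneq l k.+1.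
  by apply: (@commute_iota k 4 (Y 0) (Y 1));
    [exact: slot_iota | exact: slot_iota | vm_compute].
have [->|l3] := eqVneq l k.+2.
  by apply: (@commute_iota k 5 (Y 0) (Y 2));
    [exact: slot_iota | exact: slot_iota | vm_compute].
apply: (@commute_chunks k l 3 3 (Y 0) (Y 3)).
- lia.
- exact: slot_catl.
- exact: slot_catr.
- by vm_compute.
Qed.

Lemma psi_y_opC k l v : l != k -> l != k.+1 -> psi k (y l v) = y l (psi k v).
Proof.
move=> lk lk1; have [->|l2] := eqVneq l k.+2.
  by apply: (@commute_iota k 5 (Psi 0) (Y 2));
    [exact: slot_iota | exact: slot_iota | vm_compute].
have [->|l3] := eqVneq l k.+3.
  by apply: (@commute_iota k 6 (Psi 0) (Y 3));
    [exact: slot_iota | exact: slot_iota | vm_compute].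
have [->|l4] := eqVneq k l.+1.
  by apply: (@commute_iota l 5 (Psi 1) (Y 0));
    [exact: slot_iota | exact: slot_iota | vm_compute].
have [->|l5] := eqVneq k l.+2.
  by apply: (@commute_iota l 6 (Psi 2) (Y 0));
    [exact: slot_iota | exact: slot_iota | vm_compute].
apply: (@commute_chunks k l 4 3 (Psi 0) (Y 4)).
- lia.
- exact: slot_catl.
- exact: slot_catr.
- by vm_compute.
Qed.

Lemma vanishes_atP L P k A : (3 < L)%N -> check_windows L (vanishes_at P) ->
  (forall t b c d, cslot (iota k L) (P t b c d)) ->
  comb_op (F := F) T (pcomb (iota k L) (P (T k.+1) (A k.+1) (A k.+2) (A k.+3)))
    << A >> = 0.
Proof.
move=> L3 chk sl; apply: vanishesP => //; first exact: iota_uniq.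
by case: L L3 chk sl => [|[|[|[|L]]]] // _ chk _; exact: (check_windowsP hT A k chk).
Qed.

Lemma comb_op_cons s gs c v :
  comb_op (F := F) T ((s, gs) :: c) v =
  (-1) ^+ s *: word_op (F := F) T gs v + comb_op (F := F) T c v.
Proof. exact: big_cons. Qed.

Lemma comb_op_nil v : comb_op (F := F) T [::] v = 0.
Proof. exact: big_nil. Qed.

Lemma psi_y_vec k A :
  psi k (y k.+1 << A >>) =
  y k (psi k << A >>) + << A >> *+ eqr (T k.+1) (A k.+1) (A k.+2).
Proof.
have : comb_op (F := F) T (pcomb (iota k 4)
    (psiy_comb (T k.+1) (A k.+1) (A k.+2))) << A >> = 0.
  apply: (@vanishes_atP 4 (fun t b c _ => psiy_comb t b c)) => // t b c _.
  by rewrite /psiy_comb /cslot; case: eqr; rewrite /= /slot /= ?addnS ?addn0 ?eqxx.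
rewrite /psiy_comb /delta.
case: eqr; rewrite /pcomb [map _ _]/= !comb_op_cons comb_op_nil.
  exact: signed_eqD.
by move/signed_eq => /= ->; rewrite addr0.
Qed.

Lemma y_psi_vec k A :
  y k.+1 (psi k << A >>) =
  psi k (y k << A >>) + << A >> *+ eqr (T k.+1) (A k.+1) (A k.+2).
Proof.
have : comb_op (F := F) T (pcomb (iota k 4)
    (ypsi_comb (T k.+1) (A k.+1) (A k.+2))) << A >> = 0.
  apply: (@vanishes_atP 4 (fun t b c _ => ypsi_comb t b c)) => // t b c _.
  by rewrite /ypsi_comb /cslot; case: eqr; rewrite /= /slot /= ?addnS ?addn0 ?eqxx.
rewrite /ypsi_comb /delta.
case: eqr; rewrite /pcomb [map _ _]/= !comb_op_cons comb_op_nil.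
  exact: signed_eqD.
by move/signed_eq => /= ->; rewrite addr0.
Qed.

Lemma psi2_vec k A (t := T k.+1) (b := A k.+1) (c := A k.+2) :
  psi k (psi k << A >>) =
  if eqr t b c then 0
  else if rar t b c then y k.+1 << A >> - y k << A >>
  else if lar t b c then y k << A >> - y k.+1 << A >>
  else << A >>.
Proof.
have : comb_op (F := F) T (pcomb (iota k 4) (psi2_comb t b c)) << A >> = 0.
  apply: (@vanishes_atP 4 (fun t b c _ => psi2_comb t b c)) => // {}t {}b {}c _.
  rewrite /psi2_comb /cslot.
  by do 3?case: ifP => _; rewrite /= /slot /= ?addnS ?addn0 ?eqxx.
rewrite /psi2_comb /pcomb.
do 3?case: ifP => _; rewrite [map _ _]/= !comb_op_cons comb_op_nil.
- exact: signed_eq0.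
- exact: signed_eqB.
- exact: signed_eqB.
- exact: signed_eq.
Qed.

Lemma braid_vec k A (t := T k.+1) (b := A k.+1) (c := A k.+2) (d := A k.+3) :
  psi k (psi k.+1 (psi k << A >>)) =
  psi k.+1 (psi k (psi k.+1 << A >>)) +
    (if eqr2 t b c d && rar t b c then << A >>
     else if eqr2 t b c d && lar t b c then - << A >> else 0).
Proof.
have : comb_op (F := F) T (pcomb (iota k 5) (braid_comb t b c d)) << A >> = 0.
  apply: (@vanishes_atP 5 braid_comb) => // {}t {}b {}c {}d.
  rewrite /braid_comb /cslot.
  by do 2?case: ifP => _; rewrite /= /slot /= ?addnS ?addn0 ?eqxx.
rewrite /braid_comb /pcomb.
do 2?case: ifP => _; rewrite [map _ _]/= !comb_op_cons comb_op_nil.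
- exact: signed_eqD.
- exact: signed_eqB.
- by move/signed_eq => /= ->; rewrite addr0.
Qed.
End FockRelations.

(** * Residues *)

Definition cnt (A : config) p : nat := (\sum_(q < p) A q)%N.

Lemma cntS A p : cnt A p.+1 = (cnt A p + A p)%N.
Proof. exact: big_ord_recr. Qed.

Definition sw p q : nat := if q == p then p.+1 else if q == p.+1 then p else q.
Definition swapc (A : config) p : config := fun q => A (sw p q).

Lemma sw_l p : sw p p = p.+1.
Proof. by rewrite /sw eqxx. Qed.

Lemma sw_r p : sw p p.+1 = p.
Proof. by rewrite /sw eqxx gtn_eqF. Qed.

Lemma sw_id p q : q != p -> q != p.+1 -> sw p q = q.
Proof. by rewrite /sw => /negbTE-> /negbTE->. Qed.

Lemma cnt_swapc A p q : q != p.+1 -> cnt (swapc A p) q = cnt A q.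
Proof.
have lep r : (r <= p)%N -> cnt (swapc A p) r = cnt A r.
  move=> rp; apply: eq_bigr => i _; rewrite /swapc sw_id //;
  have := ltn_ord i; lia.
have [/lep //|pq] := leqP q p; rewrite leq_eqVlt eq_sym in pq.
case/predU1P: pq => [->|]; first by rewrite eqxx.
move=> + _; elim: q => // q IH; rewrite ltnS leq_eqVlt => /predU1P[<-|pq].
  by rewrite !cntS lep // /swapc sw_l sw_r -!addnA [(A p + _)%N]addnC.
by rewrite !cntS IH // /swapc sw_id // gtn_eqF // ltnW.
Qed.

Lemma swapcK p : involutive (swapc^~ p).
Proof.
move=> A; apply/funext => q; rewrite /swapc; congr (A _).
have [->|qp] := eqVneq q p; first by rewrite sw_l sw_r.
have [->|qp1] := eqVneq q p.+1; first by rewrite sw_r sw_l.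
by rewrite !sw_id.
Qed.

Lemma sw_far p q l : (p.+1 < q)%N || (q.+1 < p)%N -> l = p \/ l = p.+1 ->
  sw q l = l.
Proof. by move=> pq lp; rewrite sw_id //; lia. Qed.

Lemma swC p q l : (p.+1 < q)%N || (q.+1 < p)%N -> sw p (sw q l) = sw q (sw p l).
Proof.
move=> pq; have qp : (q.+1 < p)%N || (p.+1 < q)%N by rewrite orbC.
have [->|lp] := eqVneq l p.
  by rewrite sw_l !(sw_far pq) ?sw_l; auto.
have [->|lp1] := eqVneq l p.+1.
  by rewrite sw_r !(sw_far pq) ?sw_r; auto.
have [->|lq] := eqVneq l q.
  by rewrite sw_l !(sw_far qp) ?sw_l; auto.
have [->|lq1] := eqVneq l q.+1.
  by rewrite sw_r !(sw_far qp) ?sw_r; auto.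
by rewrite !sw_id.
Qed.

Lemma swapcC p q A : (p.+1 < q)%N || (q.+1 < p)%N ->
  swapc (swapc A p) q = swapc (swapc A q) p.
Proof.
by move=> pq; apply/funext => l; rewrite /swapc swC.
Qed.

Lemma swapc_l A p : swapc A p p = A p.+1.
Proof. by rewrite /swapc sw_l. Qed.
Lemma swapc_r A p : swapc A p p.+1 = A p.
Proof. by rewrite /swapc sw_r. Qed.
Lemma swapc_id A p q : q != p -> q != p.+1 -> swapc A p q = A q.
Proof. by move=> qp qp1; rewrite /swapc sw_id. Qed.

Lemma jump_up A p : A p = true -> A p.+1 = false -> jump A p p.+1 = swapc A p.
Proof.
move=> ? ?; apply/funext => q; rewrite /jump /upd /swapc /sw.
by repeat case: eqP => ?; try lia; congruence.
Qed.

Lemma jump_down A p : A p = false -> A p.+1 = true -> jump A p.+1 p = swapc A p.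
Proof.
move=> ? ?; apply/funext => q; rewrite /jump /upd /swapc /sw.
by repeat case: eqP => ?; try lia; congruence.
Qed.

Lemma jump_via A i j l : i != j -> j != l -> A j = false ->
  jump A i l = jump (jump A i j) j l.
Proof.
move=> /eqP ? /eqP ? ?; apply/funext => q; rewrite /jump /upd.
by repeat case: eqP => ?; try lia; congruence.
Qed.

(** Entries are indistinguishable: jumping over an occupied position is the same as moving that
    entry on and filling its place. *)
Lemma jump_past A i j l : i != j -> j != l -> i != l -> A j = true ->
  jump A i l = jump (jump A j l) i j.
Proof.
move=> /eqP ? /eqP ? /eqP ? ?; apply/funext => q; rewrite /jump /upd.
by repeat case: eqP => ?; try lia; congruence.
Qed.

Lemma jump_down2 A p : A p = false -> A p.+2 = true ->
  jump A p.+2 p = if A p.+1 then swapc (swapc A p) p.+1 else swapc (swapc A p.+1) p.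
Proof.
move=> A0 A2; case A1 : (A p.+1).
  rewrite (@jump_past _ _ p.+1) //; try lia.
  rewrite (@jump_down A) // jump_down // /swapc; first by rewrite sw_r.
  by rewrite sw_id //; lia.
rewrite (@jump_via _ _ p.+1) //; try lia.
rewrite (@jump_down A) // jump_down // /swapc; last by rewrite sw_l.
by rewrite sw_id //; lia.
Qed.

Section Residues.
Variables (e : nat) (kappa1 kappa2 : 'Z_e).
Hypothesis he : (3 <= e)%N.
Local Notation c := (kappa2 - kappa1 + 1).

Definition ptype_at (p : nat) : ptype :=
  if p%:R == c then Tz else if p%:R == c + 1 then Tp
  else if p%:R == c - 1 then Tm else Tg.
Local Notation T := ptype_at.

(** The form in which e >= 3 enters: 1 and 2 are nonzero, so the classes 0, 1, -1 are distinct. *)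
Lemma Ze_neq0 k : (0 < k < 3)%N -> (k%:R : 'Z_e) != 0.
Proof.
move=> /andP[k0 k3]; apply/eqP => /(congr1 val) /=.
rewrite val_Zp_nat; last lia.
by rewrite modn_small; lia.
Qed.

Lemma eq_of_sub (a b a' b' : 'Z_e) : a - b = a' - b' -> (a == b) = (a' == b').
Proof. by move=> E; rewrite -subr_eq0 E subr_eq0. Qed.

Lemma neq_of_sub k (a b : 'Z_e) :
  a - b = k%:R -> (0 < k < 3)%N -> (a == b) = false.
Proof. by move=> E k0; rewrite -subr_eq0 E; apply/negbTE/Ze_neq0. Qed.

Lemma is_tzE p : is_tz (T p) = (p%:R == c).
Proof. by rewrite /T; case: eqP => // _; do 2?[case: ifP => _ //]. Qed.

Lemma is_tpE p : is_tp (T p) = (p%:R == c + 1).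
Proof.
rewrite /T; case: eqP => [->|_]; last by case: ifP => _ //; case: ifP.
by apply/esym; rewrite eq_sym (@neq_of_sub 1) // addrC addKr.
Qed.

Lemma is_tmE p : is_tm (T p) = (p%:R == c - 1).
Proof.
rewrite /T; case: eqP => [->|_].
  by apply/esym; rewrite (@neq_of_sub 1) // opprB addrC addrNK.
case: eqP => [->|_]; last by case: ifP.
by apply/esym; rewrite (@neq_of_sub 2) //; ring.
Qed.

Lemma is_tz_succ p : is_tz (T p.+1) = is_tm (T p).
Proof. by rewrite is_tzE is_tmE; apply: eq_of_sub; rewrite -natr1; ring. Qed.

Lemma is_tp_succ p : is_tp (T p.+1) = is_tz (T p).
Proof. by rewrite is_tzE is_tpE; apply: eq_of_sub; rewrite -natr1; ring. Qed.

Lemma ptype_succ p (P : pred ptype) : all P (tnext (T p)) -> P (T p.+1).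
Proof.
have := is_tz_succ p; have := is_tp_succ p.
by case: (T p); case: (T p.+1) => //= _ _; rewrite ?andbT // => /andP[].
Qed.

(** The residue of v(a_1, ..., a_m) at p. With the dummy occupied, [cnt A p] equals j at p = a_j,
    which gives kappa2 - (j - 1). At an empty p it leaves p - [cnt A p] empty positions in [1, p),
    whence the residue kappa1 + (p - [cnt A p]). *)
Definition residue (A : config) p : 'Z_e :=
  (if A p then kappa2 + 1 else kappa1 + p%:R) - (cnt A p)%:R.

Lemma residue_eq A p :
  (residue A p == residue A p.+1) = eqr (T p) (A p) (A p.+1).
Proof.
rewrite /residue cntS natrD /eqr is_tzE -natr1.
case: (A p); case: (A p.+1); rewrite /= ?andbF ?andbT.
- by apply: (@neq_of_sub 1) => //; ring.
- by rewrite eq_sym; apply: eq_of_sub; ring.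
- by apply: eq_of_sub; ring.
- by rewrite eq_sym; apply: (@neq_of_sub 1) => //; ring.
Qed.

Lemma residue_rarrow A p :
  rarrow (residue A p) (residue A p.+1) = rar (T p) (A p) (A p.+1).
Proof.
rewrite /rarrow /residue cntS natrD -natr1.
case: (A p); case: (A p.+1); rewrite /= ?is_tpE ?is_tmE.
- by rewrite eq_sym; apply: (@neq_of_sub 2) => //; ring.
- by apply: eq_of_sub; ring.
- by rewrite eq_sym; apply: eq_of_sub; ring.
- by apply/eqP; ring.
Qed.

Lemma residue_larrow A p :
  larrow (residue A p) (residue A p.+1) = lar (T p) (A p) (A p.+1).
Proof.
rewrite /larrow /residue cntS natrD -natr1.
case: (A p); case: (A p.+1); rewrite /= ?is_tpE ?is_tmE.
- by apply/eqP; ring.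
- by apply: eq_of_sub; ring.
- by rewrite eq_sym; apply: eq_of_sub; ring.
- by apply: (@neq_of_sub 2) => //; ring.
Qed.

Lemma residue_eq2 A p :
  (residue A p.+2 == residue A p) = eqr2 (T p) (A p) (A p.+1) (A p.+2).
Proof.
rewrite /residue !cntS !natrD -!natr1 /eqr2 is_tzE is_tmE.
case: (A p); case: (A p.+1); case: (A p.+2); rewrite /=.
- by rewrite eq_sym; apply: (@neq_of_sub 2) => //; ring.
- by apply: eq_of_sub; ring.
- by rewrite eq_sym; apply: (@neq_of_sub 1) => //; ring.
- by apply: eq_of_sub; ring.
- by rewrite eq_sym; apply: eq_of_sub; ring.
- by apply: (@neq_of_sub 1) => //; ring.
- by rewrite eq_sym; apply: eq_of_sub; ring.
- by apply: (@neq_of_sub 2) => //; ring.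
Qed.

Lemma residue_swapc A p q : A p != A p.+1 ->
  residue (swapc A p) q = residue A (sw p q).
Proof.
move=> Ap; have [->|qp1] := eqVneq q p.+1.
  rewrite sw_r /residue cntS cnt_swapc ?ltn_eqF // /swapc sw_l sw_r.
  by rewrite natrD -natr1; case: (A p) Ap; case: (A p.+1) => //= _; ring.
have [->|qp] := eqVneq q p.
  rewrite sw_l /residue cnt_swapc ?ltn_eqF // /swapc sw_l cntS natrD -natr1.
  by case: (A p) Ap; case: (A p.+1) => //= _; ring.
by rewrite /residue cnt_swapc // /swapc sw_id.
Qed.

Lemma residue_swapc_tz A p q : is_tz (T p) ->
  residue (swapc A p) q = residue A q.
Proof.
move=> tz; have [Ap|Ap] := eqVneq (A p) (A p.+1).
  suff -> : swapc A p = A by [].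
  by apply/funext => r; rewrite /swapc /sw; do 2?case: eqP => [->|_].
have /eqP E : residue A p == residue A p.+1 by rewrite residue_eq /eqr tz.
by rewrite residue_swapc // /sw; do 2?case: eqP => [->|_].
Qed.
End Residues.

(** * Effect of the moves on residue sequences *)

Section Moves.
Variables (F : fieldType) (e : nat) (kappa1 kappa2 : 'Z_e).
Hypothesis he : (3 <= e)%N.
Local Notation T := (ptype_at kappa1 kappa2).
Local Notation res := (residue kappa1 kappa2).
Local Notation V := {malg F[config]}.

(** A jump by two is a product of two adjacent exchanges, and the one at a position of type [Tz]
    does not affect the residues. Hence the double jumps of [psi_move], which occur next to such a
    position, still permute the residues by a simple transposition. *)
Lemma residue_down2 A p q : A p = false -> A p.+2 = true ->
  res (jump A p.+2 p) q =
    if is_tz (T p) then res A (sw p.+1 q) else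
    if is_tz (T p.+1) then res A (sw p q) else res (jump A p.+2 p) q.
Proof.
move=> A0 A2; rewrite jump_down2 //; case A1 : (A p.+1).
  case: ifP => t0.
    rewrite residue_swapc ?residue_swapc_tz //.
    by rewrite /swapc sw_r sw_id ?A0 ?A2 //; lia.
  case: ifP => // t1; rewrite residue_swapc_tz // residue_swapc //.
  by rewrite A0 A1.
case: ifP => t0; first by rewrite residue_swapc_tz // residue_swapc // A1 A2.
case: ifP => // t1; rewrite residue_swapc //.
  by rewrite residue_swapc_tz.
by rewrite /swapc sw_l sw_id ?A0 ?A2 //; lia.
Qed.

Variant signed_vec (P : config -> Prop) : V -> Prop :=
  | Signed0 : signed_vec P 0
  | SignedU s B of P B : signed_vec P ((-1) ^+ s *: << B >>).

Lemma psi_vec_residue k A :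
  signed_vec (fun B => forall q, res B q = res A (sw k.+1 q)) (psi_vec F T k A).
Proof.
have := is_tz_succ kappa1 kappa2 he k.+1; have := is_tp_succ kappa1 kappa2 he k.
rewrite /psi_vec /psi_move.
case A1 : (A k.+1); case A2 : (A k.+2); rewrite /= => tp tz.
- case E : (T k.+1) tp tz => /= tp tz; try exact: Signed0.
  case A0 : (A k) => /=; first exact: Signed0.
  apply: SignedU => q; rewrite addn0 addn2 residue_down2 // -tp //.
- by apply: SignedU => q; rewrite addn1 addn2 jump_up // residue_swapc // A1 A2.
- case E : (T k.+1) tp tz => /= tp tz; try exact: Signed0.
  + case A0 : (A k) => /=; first exact: Signed0.
    by apply: SignedU => q; rewrite addn0 addn2 residue_down2 // -tp.
  + case A3 : (A k.+3) => /=; last exact: Signed0.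
    by apply: SignedU => q; rewrite addn1 addn3 residue_down2 // E tz.
  + by apply: SignedU => q; rewrite addn1 addn2 jump_down // residue_swapc // A1 A2.
- case E : (T k.+1) tp tz => /= tp tz; try exact: Signed0.
  case A3 : (A k.+3) => /=; last exact: Signed0.
  by apply: SignedU => q; rewrite addn1 addn3 residue_down2 // E tz.
Qed.

Lemma y_vec_residue k A :
  signed_vec (fun B => forall q, res B q = res A q) (y_vec F T k A).
Proof.
rewrite /y_vec /y_move; case: ifP => [/and3P[tz /negbTE A1 A2]|_].
  by apply: SignedU => q; rewrite addn1 addn2 jump_down // residue_swapc_tz.
case: ifP => [/and3P[tz A1 /negbTE A0]|_]; last exact: Signed0.
by apply: SignedU => q; rewrite addn0 addn1 jump_down // residue_swapc_tz.
Qed.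
End Moves.

(** * The action of the algebra on configurations *)

Section FockModule.
Variables (F : fieldType) (e n : nat) (kappa1 kappa2 : 'Z_e).
Hypothesis he : (3 <= e)%N.
Local Notation T := (ptype_at kappa1 kappa2).
Local Notation res := (residue kappa1 kappa2).
Local Notation V := {malg F[config]}.
Local Notation psi := (psi_op F T).
Local Notation y := (y_op F T).

Lemma psi_opU k A : psi k << A >> = psi_vec F T k A.
Proof. exact: lextU. Qed.
Lemma y_opU k A : y k << A >> = y_vec F T k A.
Proof. exact: lextU. Qed.
Local Opaque psi_op y_op.

Definition residues_of (A : config) : {ffun 'I_n -> 'Z_e} :=
  [ffun k : 'I_n => res A k.+1].

Definition e_op i : {linear V -> V} :=
  lext (fun A => if residues_of A == i then << A >> else 0).

Lemma e_opU i A : e_op i << A >> = if residues_of A == i then << A >> else 0.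
Proof. exact: lextU. Qed.
Local Opaque e_op.

Lemma e_op_signed (P : config -> Prop) i b (v : V) :
  signed_vec P v -> (forall B, P B -> (residues_of B == i) = b) ->
  e_op i v = if b then v else 0.
Proof.
case=> [|s B PB] Pb; first by rewrite linear0 if_same.
by rewrite linearZ /= e_opU (Pb B PB); case: b {Pb}; rewrite ?scaler0.
Qed.

Lemma sactK (r : 'I_n.-1) : involutive (@sact e n r).
Proof. by move=> i; apply/ffunP => k; rewrite !ffunE tpermK. Qed.

Lemma residues_of_sw (r : 'I_n.-1) A B :
  (forall q, res B q = res A (sw r.+1 q)) ->
  residues_of B = sact r (residues_of A).
Proof.
move=> AB; apply/ffunP => k; rewrite !ffunE AB; congr (res A _).
case: tpermP => [->|->|/eqP kl /eqP kr]; rewrite ?sw_l ?sw_r // sw_id //.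
Qed.

Lemma psi_e_op (r : 'I_n.-1) i v : psi r (e_op i v) = e_op (sact r i) (psi r v).
Proof.
apply: (@op_ext F (psi r \o e_op i) (e_op (sact r i) \o psi r)) => A /=.
rewrite e_opU psi_opU.
rewrite (e_op_signed (b := residues_of A == i) (psi_vec_residue F _ _ he _ _)) //.
  by case: ifP => _; rewrite ?linear0 // psi_opU.
by move=> B /residues_of_sw ->; rewrite (inv_eq (@sactK r)) sactK.
Qed.

Lemma y_e_op (r : 'I_n) i v : y r (e_op i v) = e_op i (y r v).
Proof.
apply: (@op_ext F (y r \o e_op i) (e_op i \o y r)) => A /=.
rewrite e_opU y_opU.
rewrite (e_op_signed (b := residues_of A == i) (y_vec_residue F _ _ he _ _)) //.
  by case: ifP => _; rewrite ?linear0 // y_opU.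
by move=> B AB; congr (_ == _); apply/ffunP => k; rewrite !ffunE AB.
Qed.

Definition fock_act (g : klr_gen e n) : {linear V -> V} :=
  match g with
  | inl (inl i) => e_op i
  | inl (inr r) => y r
  | inr r => psi r
  end.

Definition fock (x : klr_free F e n) (v : V) : V := @free_scale F _ V fock_act x v.

Lemma fockM x z v : fock (x * z) v = fock x (fock z v).
Proof. exact/esym/free_scaleA. Qed.
Lemma fockD x z v : fock (x + z) v = fock x v + fock z v.
Proof. exact: free_scale_Dl. Qed.
Lemma fock0 v : fock 0 v = 0.
Proof. exact: free_scale_0l. Qed.
Lemma fock1 v : fock 1 v = v.
Proof. exact: free_scale_1l. Qed.
Lemma fockN x v : fock (- x) v = - fock x v.
Proof. by apply/eqP; rewrite -addr_eq0 -fockD addNr fock0. Qed.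
Lemma fock_sum (I : finType) (f : I -> klr_free F e n) v :
  fock (\sum_i f i) v = \sum_i fock (f i) v.
Proof. by apply: (big_morph (fock^~ v)) => [x z|]; rewrite ?fockD ?fock0. Qed.
Lemma fock_e i v : fock (fe F i) v = e_op i v.
Proof. exact: free_actU. Qed.
Lemma fock_y r v : fock (fy F e r) v = y r v.
Proof. exact: free_actU. Qed.
Lemma fock_psi r v : fock (fpsi F e r) v = psi r v.
Proof. exact: free_actU. Qed.

(** Behind e(i) only configurations with residue sequence i matter; on these the conditions on i in
    the relations become the local conditions checked on windows. *)
Lemma e_op_eq (f h : {linear V -> V}) i :
  (forall A, residues_of A = i -> f << A >> = h << A >>) ->
  forall v, f (e_op i v) = h (e_op i v).
Proof.
move=> fh v; apply: (@op_ext F (f \o e_op i) (h \o e_op i)) => A /=.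
by rewrite e_opU; case: eqP => [/fh|_]; rewrite ?linear0.
Qed.

Lemma residues_ofE (k : 'I_n) A i : residues_of A = i -> res A k.+1 = i k.
Proof. by move<-; rewrite ffunE. Qed.

Lemma e_opM i j v : e_op i (e_op j v) = if i == j then e_op i v else 0.
Proof.
have E : e_op i (e_op j v) = (if i == j then e_op i else \0) v.
  apply: (@op_ext F (e_op i \o e_op j) (if i == j then e_op i else \0)) => A /=.
  rewrite e_opU; case: (eqVneq i j) => [->|ij].
    by case: eqP => [Aj|]; rewrite ?linear0 ?e_opU ?Aj ?eqxx //; case: eqP.
  by case: eqP => [Aj|]; rewrite ?linear0 // e_opU Aj eq_sym (negbTE ij).
by rewrite E; case: ifP.
Qed.

Lemma e_op_sum v : \sum_i e_op i v = v.
Proof.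
elim/malg_ind: v => [|a A g IH].
  by rewrite big1 // => i _; rewrite linear0.
under eq_bigr do rewrite linearP e_opU.
rewrite big_split; congr (_ + _); last exact: IH.
rewrite -scaler_sumr; congr (a *: _).
rewrite (bigD1 (residues_of A)) //= eqxx big1 ?addr0 // => i.
by rewrite eq_sym => /negbTE ->.
Qed.

Section Idempotent.
Variables (r : 'I_n.-1) (i : {ffun 'I_n -> 'Z_e}).
Let hT := @ptype_succ e kappa1 kappa2 he.

Lemma residues_of_l A : residues_of A = i -> i (lpos r) = res A r.+1.
Proof. by move/(residues_ofE (lpos r)). Qed.
Lemma residues_of_r A : residues_of A = i -> i (rpos r) = res A r.+2.
Proof. by move/(residues_ofE (rpos r)). Qed.

Lemma psi_y_e_op v :
  psi r (y (rpos r) (e_op i v)) =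
  y (lpos r) (psi r (e_op i v)) + e_op i v *+ (i (lpos r) == i (rpos r)).
Proof.
case: eqP => ir.
  apply: (@e_op_eq (psi r \o y (rpos r)) ((y (lpos r) \o psi r) \+ idfun)).
  move=> A Ai /=; rewrite (psi_y_vec F hT) -(residue_eq _ _ he).
  by rewrite -(residues_of_l Ai) -(residues_of_r Ai) ir eqxx.
rewrite addr0; apply: (@e_op_eq (psi r \o y (rpos r)) (y (lpos r) \o psi r)).
move=> A Ai /=; rewrite (psi_y_vec F hT) -(residue_eq _ _ he).
by rewrite -(residues_of_l Ai) -(residues_of_r Ai) (introF eqP ir) addr0.
Qed.

Lemma y_psi_e_op v :
  y (rpos r) (psi r (e_op i v)) =
  psi r (y (lpos r) (e_op i v)) + e_op i v *+ (i (lpos r) == i (rpos r)).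
Proof.
case: eqP => ir.
  apply: (@e_op_eq (y (rpos r) \o psi r) ((psi r \o y (lpos r)) \+ idfun)).
  move=> A Ai /=; rewrite (y_psi_vec F hT) -(residue_eq _ _ he).
  by rewrite -(residues_of_l Ai) -(residues_of_r Ai) ir eqxx.
rewrite addr0; apply: (@e_op_eq (y (rpos r) \o psi r) (psi r \o y (lpos r))).
move=> A Ai /=; rewrite (y_psi_vec F hT) -(residue_eq _ _ he).
by rewrite -(residues_of_l Ai) -(residues_of_r Ai) (introF eqP ir) addr0.
Qed.

Lemma psi2_e_op v :
  psi r (psi r (e_op i v)) =
  if i (lpos r) == i (rpos r) then 0
  else if rarrow (i (lpos r)) (i (rpos r))
       then y (rpos r) (e_op i v) - y (lpos r) (e_op i v)
  else if larrow (i (lpos r)) (i (rpos r))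
       then y (lpos r) (e_op i v) - y (rpos r) (e_op i v)
  else e_op i v.
Proof.
have basis A : residues_of A = i -> psi r (psi r << A >>) =
    if i (lpos r) == i (rpos r) then 0
    else if rarrow (i (lpos r)) (i (rpos r))
         then y (rpos r) << A >> - y (lpos r) << A >>
    else if larrow (i (lpos r)) (i (rpos r))
         then y (lpos r) << A >> - y (rpos r) << A >>
    else << A >>.
  move=> Ai; rewrite (psi2_vec F hT) -(residue_eq _ _ he).
  by rewrite -(residue_rarrow _ _ he) -(residue_larrow _ _ he)
    -(residues_of_l Ai) -(residues_of_r Ai).
do 3?case: ifP basis => _ basis.
- exact: (@e_op_eq (psi r \o psi r) \0).
- exact: (@e_op_eq (psi r \o psi r) (y (rpos r) \- y (lpos r))).
- exact: (@e_op_eq (psi r \o psi r) (y (lpos r) \- y (rpos r))).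
- exact: (@e_op_eq (psi r \o psi r) idfun).
Qed.

Lemma braid_e_op (s : 'I_n.-1) v : s = r.+1 :> nat ->
  psi r (psi s (psi r (e_op i v))) =
  if (i (rpos s) == i (lpos r)) && rarrow (i (lpos r)) (i (rpos r))
  then psi s (psi r (psi s (e_op i v))) + e_op i v
  else if (i (rpos s) == i (lpos r)) && larrow (i (lpos r)) (i (rpos r))
  then psi s (psi r (psi s (e_op i v))) - e_op i v
  else psi s (psi r (psi s (e_op i v))).
Proof.
move=> sr.
have basis A : residues_of A = i -> psi r (psi s (psi r << A >>)) =
    if (i (rpos s) == i (lpos r)) && rarrow (i (lpos r)) (i (rpos r))
    then psi s (psi r (psi s << A >>)) + << A >>
    else if (i (rpos s) == i (lpos r)) && larrow (i (lpos r)) (i (rpos r))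
    then psi s (psi r (psi s << A >>)) - << A >>
    else psi s (psi r (psi s << A >>)).
  move=> Ai; have := braid_vec F hT r A; cbv zeta; rewrite -(residue_eq2 _ _ he).
  rewrite -(residue_rarrow _ _ he) -(residue_larrow _ _ he).
  rewrite -(residues_of_l Ai) -(residues_of_r Ai).
  have -> : res A r.+3 = i (rpos s) by rewrite -(residues_ofE (rpos s) Ai) /= sr.
  rewrite sr; move: (psi r) (psi r.+1) => P Q ->.
  by case: ifP => // _; case: ifP => // _; rewrite addr0.
move: basis; move: (psi r) (psi s) => P Q basis.
do 2?case: ifP basis => _ basis.
- exact: (@e_op_eq (P \o (Q \o P)) ((Q \o (P \o Q)) \+ idfun)).
- exact: (@e_op_eq (P \o (Q \o P)) ((Q \o (P \o Q)) \- idfun)).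
- exact: (@e_op_eq (P \o (Q \o P)) (Q \o (P \o Q))).
Qed.
End Idempotent.

(* Below, generators are generalised before rewriting, because comparing two
   products in the free algebra by conversion is very slow. *)
Local Opaque fock fe fy fpsi.
Lemma klr_rel_fock u v : klr_rel u v -> fock u =1 fock v.
Proof.
have hT := @ptype_succ e kappa1 kappa2 he.
case=> [i j||r i|r i|r s|r s sl sr|r s rs|r i|r i|r i|r s i sr] w.
- by rewrite fockM !fock_e e_opM; case: ifP; rewrite ?fock0 ?fock_e.
- by rewrite fock_sum fock1; under eq_bigr do rewrite fock_e; apply: e_op_sum.
- have := fock_e i; have := fock_y r; move: (fe F i) (fy F e r) => E Y yE eE.
  by rewrite [LHS]fockM [RHS]fockM !yE !eE y_e_op.
- have := fock_e i; have := fock_e (sact r i); have := fock_psi r.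
  move: (fe F i) (fe F (sact r i)) (fpsi F e r) => E E' P pE eE' eE.
  by rewrite [LHS]fockM [RHS]fockM eE !pE eE' psi_e_op.
- have := fock_y r; have := fock_y s; move: (fy F e r) (fy F e s) => Y Y' y'E yE.
  by rewrite [LHS]fockM [RHS]fockM !yE !y'E (y_opC hT).
- have := fock_psi r; have := fock_y s; move: (fpsi F e r) (fy F e s) => P Y yE pE.
  by rewrite [LHS]fockM [RHS]fockM !pE !yE (psi_y_opC hT).
- have := fock_psi r; have := fock_psi s.
  move: (fpsi F e r) (fpsi F e s) => P P' p'E pE.
  rewrite [LHS]fockM [RHS]fockM !pE !p'E; case/orP: rs => [rs|sr].
    by rewrite (psi_opC hT).
  by rewrite [RHS](psi_opC hT).
- have := fock_e i; have := fock_psi r; have := fock_y (lpos r).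
  have := fock_y (rpos r); have := psi_y_e_op r i w.
  move: (fe F i) (fpsi F e r) (fy F e (lpos r)) (fy F e (rpos r)).
  move=> E P Y Y' H y'E yE pE eE; move: H; case: eqP => _ H.
    by rewrite 2![LHS]fockM [RHS]fockM fockD fock1 [in RHS]fockM !eE !y'E !pE yE H.
  by rewrite 2![LHS]fockM [RHS]fockM fockD fock0 [in RHS]fockM !eE !y'E !pE yE H.
- have := fock_e i; have := fock_psi r; have := fock_y (lpos r).
  have := fock_y (rpos r); have := y_psi_e_op r i w.
  move: (fe F i) (fpsi F e r) (fy F e (lpos r)) (fy F e (rpos r)).
  move=> E P Y Y' H y'E yE pE eE; move: H; case: eqP => _ H.
    by rewrite 2![LHS]fockM [RHS]fockM fockD fock1 [in RHS]fockM !eE !yE !pE y'E H.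
  by rewrite 2![LHS]fockM [RHS]fockM fockD fock0 [in RHS]fockM !eE !yE !pE y'E H.
- have := fock_e i; have := fock_psi r; have := fock_y (lpos r).
  have := fock_y (rpos r); have := psi2_e_op r i w.
  move: (fe F i) (fpsi F e r) (fy F e (lpos r)) (fy F e (rpos r)).
  move=> E P Y Y' H y'E yE pE eE; rewrite expr2 2![LHS]fockM eE !pE H.
  case: ifP => _; first by rewrite fock0.
  case: ifP => _; first by rewrite fockM fockD fockN eE yE y'E.
  case: ifP => _; first by rewrite fockM fockD fockN eE yE y'E.
  by rewrite eE.
- have := fock_e i; have := fock_psi r; have := fock_psi s.
  have := braid_e_op i w sr.
  move: (fe F i) (fpsi F e r) (fpsi F e s) => E P P' H p'E pE eE.
  rewrite 3![LHS]fockM eE !pE !p'E H.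
  case: ifP => _.
    by rewrite [RHS]fockM fockD fock1 (fockM _ P') (fockM P') !eE !p'E !pE ?p'E.
  case: ifP => _.
    by rewrite [RHS]fockM fockD fockN fock1 (fockM _ P') (fockM P') !eE !p'E !pE ?p'E.
  by rewrite [RHS]fockM (fockM _ P') (fockM P') !eE !p'E !pE ?p'E.
Qed.
End FockModule.

(** * The standard basis of the Specht module *)

Section KlrRelations.
Variables (F : fieldType) (e n : nat).
Local Notation klr := (klr F e n).
Local Notation pi := (ring_pi (@klr_relator F e n)).
Local Notation ke := (@ke F e n).
Local Notation ky := (ky F e).
Local Notation kpsi := (kpsi F e).
Local Notation residues := {ffun 'I_n -> 'Z_e}.

Definition kc (a : F) : klr := pi a%:MP.

Lemma klr_relP u v : klr_rel u v -> pi u = pi v.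
Proof. by move=> uv; apply/ring_piP/ideal_spanP/Ideal_mem; exists u, v. Qed.

Lemma piM u v : pi (u * v) = pi u * pi v.
Proof. exact: rmorphM. Qed.
Lemma piD u v : pi (u + v) = pi u + pi v.
Proof. exact: rmorphD. Qed.
Lemma piB u v : pi (u - v) = pi u - pi v.
Proof. exact: rmorphB. Qed.
Lemma pi1 : pi 1 = 1.
Proof. exact: rmorph1. Qed.
Lemma pi0 : pi 0 = 0.
Proof. exact: rmorph0. Qed.

Variable M : lmodType klr.
Implicit Types (v : M) (r s : 'I_n.-1) (i : residues).

Section Abstract.
Implicit Types (a b c d p : klr_free F e n).

Lemma pi_act2 a b v : pi (a * b) *: v = pi a *: (pi b *: v).
Proof. by rewrite piM scalerA. Qed.

Lemma pi_actD a b v : pi (a + b) *: v = pi a *: v + pi b *: v.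
Proof. by rewrite piD scalerDl. Qed.

Lemma pi_actN a v : pi (- a) *: v = - (pi a *: v).
Proof.
by apply/eqP; rewrite -addr_eq0 -pi_actD addNr pi0 scale0r.
Qed.

Lemma pi_act1 v : pi 1 *: v = v.
Proof. by rewrite pi1 scale1r. Qed.

Lemma pi_act0 v : pi 0 *: v = 0.
Proof. by rewrite pi0 scale0r. Qed.

Lemma rel_act a b v : klr_rel a b -> pi a *: v = pi b *: v.
Proof. by move/klr_relP ->. Qed.

Lemma rel_comm a b c d v : klr_rel (a * b) (c * d) ->
  pi a *: (pi b *: v) = pi c *: (pi d *: v).
Proof. by move=> H; rewrite -[LHS]pi_act2 -[RHS]pi_act2; apply: rel_act. Qed.

Lemma rel_idem a b c (c1 : bool) v : klr_rel (a * b) (if c1 then c else 0) ->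
  pi a *: (pi b *: v) = if c1 then pi c *: v else 0.
Proof.
by move=> H; rewrite -[LHS]pi_act2 (rel_act v H); case: (c1); rewrite ?pi_act0.
Qed.

Lemma rel_delta a b c d p (c1 : bool) v : pi p *: v = v ->
  klr_rel (a * b * p) ((c * d + c1%:R) * p) ->
  pi a *: (pi b *: v) = pi c *: (pi d *: v) + v *+ c1.
Proof.
move=> pv H; rewrite -[in LHS]pv -2![LHS]pi_act2 (rel_act v H).
rewrite [LHS]pi_act2 pv pi_actD [in LHS]pi_act2; congr (_ + _).
by case: (c1); rewrite ?pi_act1 ?pi_act0.
Qed.

Lemma rel_square a b c p (c1 c2 c3 : bool) v : pi p *: v = v ->
  klr_rel (a ^+ 2 * p)
    (if c1 then 0 else if c2 then (c - b) * p else if c3 then (b - c) * p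
     else p) ->
  pi a *: (pi a *: v) =
  if c1 then 0
  else if c2 then pi c *: v - pi b *: v
  else if c3 then pi b *: v - pi c *: v
  else v.
Proof.
rewrite expr2 => pv H; rewrite -[in LHS]pv -2![LHS]pi_act2 (rel_act v H).
case: (c1); first exact: pi_act0.
by case: (c2); last case: (c3) => //; rewrite [LHS]pi_act2 pv pi_actD pi_actN.
Qed.

(** The value of the scalar is forgotten, since the term that it multiplies will count as a shorter
    vector. *)
Lemma rel_braid a b p (c1 c2 : bool) v : pi p *: v = v ->
  klr_rel (a * b * a * p)
    (if c1 then (b * a * b + 1) * p else if c2 then (b * a * b - 1) * p
     else b * a * b * p) ->
  exists x : F, pi a *: (pi b *: (pi a *: v)) =
    pi b *: (pi a *: (pi b *: v)) + kc x *: v.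
Proof.
move=> pv /(rel_act v) H.
have bab : pi (b * a * b) *: v = pi b *: (pi a *: (pi b *: v)).
  by rewrite 2!pi_act2.
have -> : pi a *: (pi b *: (pi a *: v)) = pi (a * b * a * p) *: v.
  by rewrite 3![RHS]pi_act2 pv.
rewrite {}H /kc; case: (c1); last case: (c2).
- exists 1; rewrite [1%:MP](rmorph1 (malgC)) pi_act1.
  by rewrite [LHS]pi_act2 pv pi_actD pi_act1 bab.
- exists (-1); rewrite [(-1)%:MP](rmorphN1 (malgC)) pi_actN pi_act1.
  by rewrite [LHS]pi_act2 pv pi_actD pi_actN pi_act1 bab.
- exists 0; rewrite [0%:MP](rmorph0 (malgC)) pi_act0 addr0.
  by rewrite [LHS]pi_act2 pv bab.
Qed.
End Abstract.

Lemma ke_act i j v : ke i *: (ke j *: v) = if i == j then ke i *: v else 0.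
Proof. exact: rel_idem (Rel_ee F i j). Qed.

Lemma kpsi_ke r i v : kpsi r *: (ke i *: v) = ke (sact r i) *: (kpsi r *: v).
Proof. exact: rel_comm (Rel_psie F r i). Qed.

Lemma kpsi_ky r q v : q != lpos r -> q != rpos r ->
  kpsi r *: (ky q *: v) = ky q *: (kpsi r *: v).
Proof. by move=> ql qr; exact: rel_comm (Rel_psiy F e ql qr). Qed.

Lemma kpsiC r s v : (r.+1 < s)%N || (s.+1 < r)%N ->
  kpsi r *: (kpsi s *: v) = kpsi s *: (kpsi r *: v).
Proof. by move=> rs; exact: rel_comm (Rel_psipsi F e rs). Qed.

Lemma kpsi_ky_rpos r i v : ke i *: v = v ->
  kpsi r *: (ky (rpos r) *: v) =
  ky (lpos r) *: (kpsi r *: v) + v *+ (i (lpos r) == i (rpos r)).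
Proof. by move=> iv; exact: rel_delta (Rel_psiyr F r i). Qed.

Lemma ky_kpsi_rpos r i v : ke i *: v = v ->
  ky (rpos r) *: (kpsi r *: v) =
  kpsi r *: (ky (lpos r) *: v) + v *+ (i (lpos r) == i (rpos r)).
Proof. by move=> iv; exact: rel_delta (Rel_ypsir F r i). Qed.

Lemma kpsi2 r i v : ke i *: v = v ->
  kpsi r *: (kpsi r *: v) =
  if i (lpos r) == i (rpos r) then 0
  else if rarrow (i (lpos r)) (i (rpos r))
       then ky (rpos r) *: v - ky (lpos r) *: v
  else if larrow (i (lpos r)) (i (rpos r))
       then ky (lpos r) *: v - ky (rpos r) *: v
  else v.
Proof. by move=> iv; exact: rel_square (Rel_psi2 F r i). Qed.

Lemma kbraid r s i v : s = r.+1 :> nat -> ke i *: v = v ->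
  exists a : F, kpsi r *: (kpsi s *: (kpsi r *: v)) =
    kpsi s *: (kpsi r *: (kpsi s *: v)) + kc a *: v.
Proof. by move=> sr iv; exact: rel_braid (Rel_braid F i sr). Qed.

Lemma malgC_central (a : F) (g : klr_free F e n) : a%:MP * g = g * a%:MP.
Proof.
rewrite mul_malgC malgZ_def malgM_def fgmulgU /fgscale.
by apply: eq_bigr => k _; rewrite mulm1 mulrC.
Qed.

Lemma kc_central a (x : klr) v : kc a *: (x *: v) = x *: (kc a *: v).
Proof.
by rewrite !scalerA -[x]ring_reprK /kc -!piM malgC_central.
Qed.
End KlrRelations.

(** * Standard vectors span a module generated by a vector with the Specht relations *)

Definition config0 (m : nat) : config := fun p => (p <= m)%N.

Lemma cnt_config0 m p : cnt (config0 m) p = minn p m.+1.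
Proof.
elim: p => [|p IH]; first by rewrite /cnt big_ord0 min0n.
rewrite cntS IH /config0; case: leqP => pm; lia.
Qed.

Section Standard.
Variables (F : fieldType) (e n : nat) (kappa1 kappa2 : 'Z_e) (m : nat).
Hypotheses (he : (3 <= e)%N) (hm : (m <= n)%N).
Local Notation klr := (klr F e n).
Local Notation ke := (@ke F e n).
Local Notation ky := (ky F e).
Local Notation kpsi := (kpsi F e).
Local Notation kc := (@kc F e n).
Local Notation resof := (residues_of n kappa1 kappa2).

Lemma residues_of_config0 : resof (config0 m) = hook_residues n kappa1 kappa2 m.
Proof.
apply/ffunP => k; rewrite !ffunE /residue cnt_config0 /config0.
case: ltnP => km.
  by rewrite (minn_idPl _) ?ltnS ?(ltnW km) // -natr1 opprD addrACA subrr addr0.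
rewrite (minn_idPr _) // natrB // -!natr1.
by ring.
Qed.

Variables (M : lmodType klr) (z : M).
Hypothesis ze : ke (hook_residues n kappa1 kappa2 m) *: z = z.
Hypothesis zy : forall q, ky q *: z = 0.
Hypothesis zpsi : forall r : 'I_n.-1, r.+1 <> m -> kpsi r *: z = 0.

(* [std k A s]: [s] is the standard basis vector of [A], obtained from [z] by [k]
   applications of generators [psi]. *)
Inductive std : nat -> config -> M -> Prop :=
  | Std0 : std 0 (config0 m) z
  | StdS k A s (r : 'I_n.-1) of std k A s & A r.+1 & ~~ A r.+2 :
      std k.+1 (swapc A r.+1) (kpsi r *: s).

Lemma residues_of_swapc (A : config) (r : 'I_n.-1) : A r.+1 -> ~~ A r.+2 ->
  resof (swapc A r.+1) = sact r (resof A).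
Proof.
move=> A1 A2; apply: residues_of_sw => q; apply: residue_swapc => //.
by rewrite A1 (negbTE A2).
Qed.

Lemma std_residues k A s : std k A s -> ke (resof A) *: s = s.
Proof.
elim=> [|{}k {}A {}s r sA IH A1 A2]; first by rewrite residues_of_config0.
by rewrite residues_of_swapc // -kpsi_ke IH.
Qed.

Lemma std_down k A s (r : 'I_n.-1) : std k A s -> ~~ A r.+1 -> A r.+2 ->
  exists k' t, [/\ k = k'.+1, std k' (swapc A r.+1) t & s = kpsi r *: t].
Proof.
move=> sA; elim: sA r => [|{}k B t r0 sB IH B1 B2] r.
  by rewrite /config0; lia.
have [->|rr] := eqVneq r r0; first by exists k, t; rewrite swapcK.
have {}rr : r != r0 :> nat by [].
have [->|r1] := eqVneq (r : nat) r0.+1; first by rewrite swapc_r B1.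
have [r2|r2] := eqVneq (r0 : nat) r.+1; first by rewrite -r2 swapc_l (negbTE B2).
rewrite !swapc_id //; try lia.
move=> /IH{}IH /IH [k' [t' [-> sB' ->]]].
exists k'.+1, (kpsi r0 *: t'); split => //; last by apply: kpsiC; lia.
rewrite swapcC; last lia.
by apply: StdS => //; rewrite swapc_id //; lia.
Qed.

Lemma std_config0 k A s : std k A s -> A = (config0 m) -> s = z.
Proof.
case=> // {}k B t r sB B1 B2 E.
have := congr1 (fun f : config => f r.+1) E.
have := congr1 (fun f : config => f r.+2) E.
by rewrite swapc_l swapc_r B1 (negbTE B2) /config0; lia.
Qed.

Lemma std_unique k k' A s s' : std k A s -> std k' A s' -> s = s'.
Proof.
move=> sA; elim: sA k' s' => [|{}k B t r sB IH B1 B2] k' s' sA'.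
  exact/esym/(std_config0 sA').
have [||k1 [t' [_ + ->]]] := std_down (r := r) sA'.
- by rewrite swapc_l.
- by rewrite swapc_r.
by rewrite swapcK => /IH ->.
Qed.

Inductive std_span (k : nat) : M -> Prop :=
  | std_span0 : std_span k 0
  | std_spanD j A s a u of (j < k)%N & std j A s & std_span k u :
      std_span k (kc a *: s + u).

Lemma kcM a b (v : M) : kc a *: (kc b *: v) = kc (a * b) *: v.
Proof.
rewrite /kc -[LHS]pi_act2; congr (ring_pi _ _ *: _); exact/esym/(rmorphM (malgC)).
Qed.
Lemma kc1 (v : M) : kc 1 *: v = v.
Proof. by rewrite /kc [1%:MP](rmorph1 (malgC)) pi_act1. Qed.
Lemma kcD a b (v : M) : kc (a + b) *: v = kc a *: v + kc b *: v.
Proof. by rewrite /kc [(a + b)%:MP](rmorphD (malgC)) pi_actD. Qed.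

Lemma std_span_std k j A s : (j < k)%N -> std j A s -> std_span k s.
Proof.
by move=> jk sA; rewrite -[s]kc1 -[kc 1 *: s]addr0; apply: std_spanD sA (std_span0 _).
Qed.

Lemma std_span_mono k l u : (k <= l)%N -> std_span k u -> std_span l u.
Proof.
move=> kl; elim=> [|j A s a {}u jk sA _ IH]; first exact: std_span0.
exact: std_spanD (leq_trans jk kl) sA IH.
Qed.

Lemma std_span_add k u v : std_span k u -> std_span k v -> std_span k (u + v).
Proof.
move=> Lu Lv; elim: Lu => [|j A s a {}u jk sA _ IH]; first by rewrite add0r.
by rewrite -addrA; apply: std_spanD sA IH.
Qed.

Lemma std_span_kc k b u : std_span k u -> std_span k (kc b *: u).
Proof.
elim=> [|j A s a {}u jk sA _ IH]; first by rewrite scaler0; apply: std_span0.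
by rewrite scalerDr kcM; apply: std_spanD sA IH.
Qed.

Lemma kcN a (v : M) : kc (- a) *: v = - (kc a *: v).
Proof.
rewrite /kc -pi_actN; congr (ring_pi _ _ *: _); exact: (rmorphN (malgC)).
Qed.

Lemma std_span_opp k u : std_span k u -> std_span k (- u).
Proof. by rewrite -[u in - u]kc1 -kcN; apply: std_span_kc. Qed.

Lemma std_span_mulb k u (b : bool) : std_span k u -> std_span k (u *+ b).
Proof. by case: b => // _; apply: std_span0. Qed.

Lemma std_span_map (f : klr) k l :
  (forall j A s, (j < k)%N -> std j A s -> std_span l (f *: s)) ->
  forall u, std_span k u -> std_span l (f *: u).
Proof.
move=> fs u; elim=> [|j A s a {}u jk sA _ IH].
  by rewrite scaler0; apply: std_span0.
rewrite scalerDr -kc_central; apply: std_span_add IH; apply: std_span_kc.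
exact: fs sA.
Qed.

(* Up to shorter vectors, the [psi] satisfy the nil-Coxeter relations, so that
   only the moves which increase the length do not shrink. *)
Definition shrinks k := forall A s, std k A s ->
  (forall q, std_span k (ky q *: s)) /\
  (forall r : 'I_n.-1, A r.+1 ==> A r.+2 -> std_span k (kpsi r *: s)).

Lemma shrinks_y k q : (forall j, (j < k)%N -> shrinks j) ->
  forall u, std_span k u -> std_span k (ky q *: u).
Proof.
move=> sh; apply: std_span_map => j A s jk sA.
exact: std_span_mono (ltnW jk) (proj1 (sh j jk A s sA) q).
Qed.

Lemma shrinks_psi k (r : 'I_n.-1) : (forall j, (j < k)%N -> shrinks j) ->
  forall u, std_span k u -> std_span k.+1 (kpsi r *: u).
Proof.
move=> sh; apply: std_span_map => j A s jk sA.
case: (boolP (A r.+1 ==> A r.+2)) => [Ar|].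
  apply: std_span_mono (proj2 (sh j jk A s sA) r Ar); lia.
rewrite negb_imply => /andP[A1 A2].
by apply: (@std_span_std _ j.+1 (swapc A r.+1)); [lia | apply: StdS].
Qed.

(** Strong induction on the length, writing s = psi_r t. A y moves past psi_r at the cost of a
    multiple of t. For psi_q there are three cases: q = r gives zero, t or a difference of two y
    applied to t; a distant q commutes with r; a neighbour calls for the braid relation. *)
Lemma std_shrinks k : shrinks k.
Proof.
elim/ltn_ind: k => k IH A s sA.
case: sA IH => [IH|{}k B t r sB B1 B2 IH].
  split=> [q|r Ar]; first by rewrite zy; apply: std_span0.
  by rewrite zpsi; [apply: std_span0 | move: Ar; rewrite /config0; lia].
have IHk j : (j < k)%N -> shrinks j by move=> jk; apply: IH; lia.
have IHk1 j : (j < k.+1)%N -> shrinks j by exact: IH.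
have [yt psit] := IH k (ltnSn k) B t sB.
have tL : std_span k.+1 t by exact: std_span_std sB.
have te := std_residues sB.
split=> [q|q].
- have [->|qr] := eqVneq q (rpos r).
    rewrite (ky_kpsi_rpos r te); apply: std_span_add; last exact: std_span_mulb.
    by apply: shrinks_psi => //; exact: yt.
  have [->|ql] := eqVneq q (lpos r).
    have /eqP := kpsi_ky_rpos r te; rewrite -subr_eq => /eqP <-.
    apply: std_span_add; last by apply/std_span_opp/std_span_mulb.
    by apply: shrinks_psi => //; exact: yt.
  by rewrite -kpsi_ky //; apply: shrinks_psi => //; exact: yt.
have [->|qr] := eqVneq q r.
  move=> _; rewrite (kpsi2 r te); case: ifP => _; first exact: std_span0.
  have ytB q1 q2 : std_span k.+1 (ky q1 *: t - ky q2 *: t).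
    apply: (@std_span_mono k) => //; apply: std_span_add; first exact: yt.
    by apply: std_span_opp; exact: yt.
  by do 2?[case: ifP => _; first exact: ytB].
have {}qr : q != r :> nat by [].
have [q1|q1] := eqVneq (q : nat) r.+1.
  rewrite q1 swapc_r B1 swapc_id; [|lia|lia] => /= B3.
  have [||k' [t' [kk sC ->]]] := std_down (r := q) sB; rewrite ?q1 //.
  (* With t = psi_q t', the braid relation makes psi_r act on t' first, where it does not increase
     the length. The two remaining psi then only regain what was lost. The case r = q + 1 below is
     symmetric. *)
  have [a /eqP] := kbraid q1 (std_residues sC).
  rewrite -subr_eq => /eqP <-.
  have t'L : std_span k'.+1 t' by exact: std_span_std sC.
  apply: std_span_add.
    rewrite kk; apply: shrinks_psi => [j jk|]; first by apply: IH; lia.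
    apply: shrinks_psi => [j jk|]; first by apply: IH; lia.
    have /IH/(_ _ _ sC) [_] : (k' < k.+1)%N by lia.
    by apply; rewrite q1 swapc_l swapc_id ?B1 ?B3 //; lia.
  by apply/std_span_opp/std_span_kc; rewrite kk; apply: std_span_mono t'L.
have [r1|r1] := eqVneq (r : nat) q.+1.
  rewrite -r1 swapc_l (negbTE B2) implybF swapc_id; [|lia|lia] => Bq.
  have [||k' [t' [kk sC ->]]] := std_down (r := q) sB; rewrite -?r1 //.
  have [a ->] := kbraid r1 (std_residues sC).
  have t'L : std_span k'.+1 t' by exact: std_span_std sC.
  apply: std_span_add; last first.
    by apply: std_span_kc; rewrite kk; apply: std_span_mono t'L.
  rewrite kk; apply: shrinks_psi => [j jk|]; first by apply: IH; lia.
  apply: shrinks_psi => [j jk|]; first by apply: IH; lia.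
  have /IH/(_ _ _ sC) [_] : (k' < k.+1)%N by lia.
  by apply; rewrite -r1 swapc_r (negbTE Bq).
rewrite !swapc_id; try lia; move=> Bq.
rewrite kpsiC; last lia.
by apply: shrinks_psi => //; apply: psit.
Qed.

(** Along a word of generators, the e and y preserve the bound on the length and each psi raises it
    by one. *)
Lemma std_span_full u : (exists x, u = x *: z) -> exists k, std_span k u.
Proof.
case=> x ->; rewrite -[x]ring_reprK; elim/malg_ind: (ring_repr x) => [|a w g [k IH]].
  by exists 0%N; rewrite pi_act0; apply: std_span0.
have [l Lw] : exists l, std_span l (ring_pi (@klr_relator F e n) << w >> *: z).
  rewrite -[w]fmK; elim: (w : seq _) => [|g' s [l IHs]].
    exists 1%N; rewrite [X in ring_pi _ X *: _](_ : _ = 1) ?pi_act1; last first.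
      by congr << _ >>; apply/eqP; rewrite fmP fm1.
    exact: std_span_std Std0.
  rewrite [X in ring_pi _ X *: _](_ : _ = << fmu g' >> * << FMonom s >>); last first.
    rewrite malgM_def fgmulUU mulr1; congr << _ >>; apply/eqP.
    by rewrite fmP fmM fmU.
  rewrite pi_act2; case: g' => [[i|q]|r].
  - exists l; apply: std_span_map IHs => j A t jl sA.
    rewrite -(std_residues sA) [_ *: _](ke_act i).
    case: eqP => [->|_]; last exact: std_span0.
    by rewrite (std_residues sA); exact: std_span_std sA.
  - by exists l; apply: shrinks_y IHs => j _; apply: std_shrinks.
  - by exists l.+1; apply: shrinks_psi IHs => j _; apply: std_shrinks.
exists (maxn k l); rewrite pi_actD; apply: std_span_add.
  rewrite -mul_malgC pi_act2; apply: std_span_kc; apply: std_span_mono Lw.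
  exact: leq_maxr.
by apply: std_span_mono IH; exact: leq_maxl.
Qed.
End Standard.

(** * Embedding the Specht module into the space of configurations *)

Definition scalar_mod (F : fieldType) (e n : nat) (M : lmodType (klr F e n)) : Type := M.

Section ScalarModule.
Variables (F : fieldType) (e n : nat) (M : lmodType (klr F e n)).
Local Notation MF := (scalar_mod M).
HB.instance Definition _ := GRing.Zmodule.on MF.

Definition scalar_scale (a : F) (v : MF) : MF := kc e n a *: (v : M).

Fact scalar_scaleA a b v :
  scalar_scale a (scalar_scale b v) = scalar_scale (a * b) v.
Proof. exact: kcM. Qed.
Fact scalar_scale1 : left_id 1 scalar_scale.
Proof. exact: kc1. Qed.
Fact scalar_scaleDr : right_distributive scalar_scale +%R.
Proof. by move=> a u v; exact: scalerDr. Qed.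
Fact scalar_scaleDl v : {morph scalar_scale^~ v : a b / a + b}.
Proof. by move=> a b; exact: kcD. Qed.

HB.instance Definition _ := GRing.Zmodule_isLmodule.Build F MF
  scalar_scaleA scalar_scale1 scalar_scaleDr scalar_scaleDl.
End ScalarModule.

Section QuotientUniversal.
Variables (R : pzRingType) (X : R^o -> Prop) (V : zmodType).
Variables (act : R -> V -> V) (v0 : V).
Hypothesis actM : forall x x' v, act (x * x') v = act x (act x' v).
Hypothesis actD : forall x x' v, act (x + x') v = act x v + act x' v.
Hypothesis act0 : forall v, act 0 v = 0.
Hypothesis actX : forall x, submod_gen X x -> act x v0 = 0.

Definition quot_gen : quot_module X := module_pi X (1 : R^o).
Local Notation z := quot_gen.

Lemma module_pi_gen (x : R) : module_pi X (x : R^o) = x *: z.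
Proof. by rewrite /z -linearZ /=; congr module_pi; rewrite [RHS]mulr1. Qed.

Lemma quot_cyclic (u : quot_module X) : exists x : R, u = x *: z.
Proof. by exists (module_repr u); rewrite -module_pi_gen module_reprK. Qed.

Lemma quot_rel0 (x : R) : X x -> x *: z = 0.
Proof.
move=> rx; rewrite -module_pi_gen -(raddf0 (module_pi X)).
by apply/module_piP; rewrite subr0; apply/submod_spanP/Submod_mem.
Qed.

Definition quot_eval (u : quot_module X) : V := act (module_repr u) v0.

Lemma quot_eval_gen (x : R) : quot_eval (x *: z) = act x v0.
Proof.
rewrite -module_pi_gen /quot_eval; set x' := module_repr _.
have /submod_spanP/actX : (x : R^o) - x' \in submod_span X.
  by apply/module_piP; rewrite module_reprK.
by move=> E; rewrite -[x in RHS](subrK x') actD E add0r.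
Qed.

Lemma quot_evalZ x u : quot_eval (x *: u) = act x (quot_eval u).
Proof.
by have [x' ->] := quot_cyclic u; rewrite scalerA !quot_eval_gen actM.
Qed.

Lemma quot_evalD u v : quot_eval (u + v) = quot_eval u + quot_eval v.
Proof.
have [x ->] := quot_cyclic u; have [x' ->] := quot_cyclic v.
by rewrite -scalerDl !quot_eval_gen actD.
Qed.

Lemma quot_eval0 : quot_eval 0 = 0.
Proof. by rewrite -(scale0r z) quot_eval_gen act0. Qed.
End QuotientUniversal.

Section SpechtFock.
Variables (F : fieldType) (e n : nat) (kappa1 kappa2 : 'Z_e) (m : nat).
Hypotheses (he : (3 <= e)%N) (hm : (m <= n)%N).
Local Notation klr := (klr F e n).
Local Notation ke := (@ke F e n).
Local Notation ky := (ky F e).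
Local Notation kpsi := (kpsi F e).
Local Notation kc := (@kc F e n).
Local Notation T := (ptype_at kappa1 kappa2).
Local Notation V := {malg F[config]}.
Local Notation fock := (@fock F e n kappa1 kappa2).
Local Notation S := (specht F n kappa1 kappa2 m).
Local Notation srel := (specht_relator F n kappa1 kappa2 m).

Lemma fock_linear x : linear (fock x : V -> V).
Proof. exact: free_scale_linear. Qed.
Lemma fock_0r (x : klr_free F e n) : fock x 0 = 0.
Proof. by have := fock_linear x (-1) 0 0; rewrite scaler0 addr0 scaleN1r addNr. Qed.
Lemma fock_Dr (x : klr_free F e n) v w : fock x (v + w) = fock x v + fock x w.
Proof. by have := fock_linear x 1 v w; rewrite !scale1r. Qed.
Lemma fock_Zr (x : klr_free F e n) a v : fock x (a *: v) = a *: fock x v.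
Proof. by have := fock_linear x a v 0; rewrite fock_0r !addr0. Qed.
Lemma fock_C (a : F) v : fock (a%:MP : klr_free F e n) v = a *: v.
Proof. exact: free_actC. Qed.

Lemma ideal_fock (x : klr_free F e n) v :
  ideal_gen (@klr_relator F e n) x -> fock x v = 0.
Proof.
move=> ix; elim: ix v => {x} [x [a [b [ab ->]]]||x1 x2 _ IH1 _ IH2|a x _ IH|a x _ IH] v.
- by rewrite fockD fockN (klr_rel_fock kappa1 kappa2 he ab) subrr.
- exact: fock0.
- by rewrite fockD IH1 IH2 addr0.
- by rewrite fockM IH fock_0r.
- by rewrite fockM IH.
Qed.

Definition kfock (x : klr) (v : V) : V := fock (ring_repr x) v.

Lemma kfock_pi a v : kfock (ring_pi (@klr_relator F e n) a) v = fock a v.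
Proof.
apply/esym/eqP; rewrite -subr_eq0 -fockN -fockD.
by apply/eqP/ideal_fock/ideal_spanP/ring_repr_pi.
Qed.

Lemma klr_pi_surj (x : klr) : exists a, x = ring_pi (@klr_relator F e n) a.
Proof. by exists (ring_repr x); rewrite ring_reprK. Qed.

Lemma kfock_mul x1 x2 v : kfock (x1 * x2) v = kfock x1 (kfock x2 v).
Proof.
have [a ->] := klr_pi_surj x1; have [b ->] := klr_pi_surj x2.
by rewrite -(piM a b) !kfock_pi fockM.
Qed.

Lemma kfock_add x1 x2 v : kfock (x1 + x2) v = kfock x1 v + kfock x2 v.
Proof.
have [a ->] := klr_pi_surj x1; have [b ->] := klr_pi_surj x2.
by rewrite -(piD a b) !kfock_pi fockD.
Qed.

Lemma kfock_1 v : kfock 1 v = v.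
Proof. by rewrite -pi1 kfock_pi fock1. Qed.
Lemma kfock_0 v : kfock 0 v = 0.
Proof. by rewrite -pi0 kfock_pi fock0. Qed.
Lemma kfock_0r x : kfock x 0 = 0.
Proof. exact: fock_0r. Qed.

Lemma kfock_specht (x : klr^o) : submod_gen srel x -> kfock x << config0 m >> = 0.
Proof.
elim=> {x} [x||a x1 x2 _ IH1 _ IH2]; last first.
- by rewrite kfock_add [a *: _](_ : _ = a * x1) // kfock_mul IH1 IH2 kfock_0r addr0.
- exact: kfock_0.
case=> [|r|r rm].
- rewrite -pi1 -[_ - _]piB kfock_pi fockD fockN fock1 fock_e e_opU.
  by rewrite residues_of_config0 // eqxx subrr.
(* In [config0 m] no empty position precedes an occupied one, and an occupied position is followed
   by an empty one only at m: no rule applies. *)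
- rewrite kfock_pi fock_y y_opU /y_vec /y_move /config0.
  by rewrite !ifF //; lia.
- rewrite kfock_pi fock_psi psi_opU /psi_vec /psi_move /config0.
  by rewrite ifF; [case: (T _) => //; rewrite ifF //; lia | lia].
Qed.

Definition specht_gen : S := quot_gen srel.
Local Notation z := specht_gen.

Lemma specht_cyclic (u : S) : exists x : klr, u = x *: z.
Proof. exact: quot_cyclic. Qed.

Lemma specht_gen_e : ke (hook_residues n kappa1 kappa2 m) *: z = z.
Proof.
apply/eqP; rewrite -subr_eq0 -[X in _ - X]scale1r -scalerBl.
by apply/eqP/quot_rel0/Specht_e.
Qed.

Lemma specht_gen_y q : ky q *: z = 0.
Proof. exact/quot_rel0/Specht_y. Qed.

Lemma specht_gen_psi (r : 'I_n.-1) : r.+1 <> m -> kpsi r *: z = 0.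
Proof. by move=> rm; exact/quot_rel0/Specht_psi. Qed.

Definition specht_fock : S -> V := quot_eval kfock << config0 m >>.

Lemma specht_fock_gen (x : klr) : specht_fock (x *: z) = kfock x << config0 m >>.
Proof. exact: quot_eval_gen kfock_add kfock_specht x. Qed.

Lemma specht_fockZ x u : specht_fock (x *: u) = kfock x (specht_fock u).
Proof. exact: quot_evalZ kfock_mul kfock_add kfock_specht x u. Qed.

Lemma specht_fockD u v : specht_fock (u + v) = specht_fock u + specht_fock v.
Proof. exact: quot_evalD kfock_add kfock_specht u v. Qed.

Lemma specht_fock0 : specht_fock 0 = 0.
Proof. exact: quot_eval0 kfock_add kfock_0 kfock_specht. Qed.

Lemma specht_fockC a u : specht_fock (kc a *: u) = a *: specht_fock u.
Proof. by rewrite specht_fockZ kfock_pi fock_C. Qed.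

Local Notation std := (std m z).

Lemma specht_fock_std k A s : std k A s -> specht_fock s = << A >>.
Proof.
elim=> [|{}k {}A {}s r sA IH A1 /negbTE A2].
  by rewrite -[specht_gen]scale1r specht_fock_gen kfock_1.
rewrite specht_fockZ IH kfock_pi fock_psi psi_opU /psi_vec /psi_move A1 A2 /=.
by rewrite scale1r addn1 addn2 jump_up.
Qed.

Definition reachable A := exists s k, std k A s.
(** By [std_unique] the chosen vector does not depend on the choice; unreachable configurations get
    the default value 0. *)
Definition std_vec A : scalar_mod S :=
  if pselect (reachable A) is left h then projT1 (cid h) else 0.

Lemma std_vecE k A s : std k A s -> std_vec A = s.
Proof.
move=> sA; rewrite /std_vec; case: pselect => [h|[]]; last by exists s, k.
by case: cid => s' /= [k' sA']; apply: std_unique sA' sA.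
Qed.

(** The embedding takes a standard vector to its configuration and [lext std_vec] takes it back, so
    the two compose to the identity on a spanning set. Injectivity follows from this left
    inverse. *)
Lemma specht_basis (u : S) : lext std_vec (specht_fock u) = u /\
  forall A, A \in msupp (specht_fock u) -> reachable A.
Proof.
have [x ux] := specht_cyclic u.
have [k Lu] : exists k, std_span m z k u.
  exact: (std_span_full he hm specht_gen_e specht_gen_y specht_gen_psi
    (ex_intro _ x ux)).
elim: Lu => {u x ux} [|j A s a u _ sA _ [IH1 IH2]].
  by rewrite specht_fock0 linear0; split => // A; rewrite msupp0.
rewrite specht_fockD specht_fockC (specht_fock_std sA).
split=> [|B].
  by rewrite [LHS](lext_linear std_vec) -(std_vecE sA) -{2}IH1 -(lextU std_vec A).
move/(fsubsetP (msuppD_le _ _)); rewrite in_fsetU => /orP[|/IH2 //].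
move/(fsubsetP (msuppZ_le _ _)); rewrite msuppU oner_eq0 in_fset1 => /eqP ->.
by exists s, j.
Qed.

Lemma specht_fock_inj : injective specht_fock.
Proof.
by move=> u v uv; rewrite -(proj1 (specht_basis u)) uv (proj1 (specht_basis v)).
Qed.
End SpechtFock.

(** * Irreducibility *)

Section Weight.
Variables (N : nat) (g : nat -> nat).

(** Used with [g] constant 1 to count entries, and with [g = id] to get the sum of the positions,
    which decreases when an entry is lowered. *)
Definition weight (A : config) : nat := (\sum_(q < N) g q * A q)%N.

Lemma weight_jump (A : config) i j : (i < N)%N -> (j < N)%N -> A i -> ~~ A j ->
  (weight (jump A i j) + g i = weight A + g j)%N.
Proof.
move=> iN jN Ai Aj; have ij : i != j by apply: contraNneq Aj => <-.
have E (B : config) : weight B = (g i * B i + (g j * B j +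
    \sum_(q < N | (q != Ordinal iN) && (q != Ordinal jN)) g q * B q))%N.
  rewrite /weight (bigD1 (Ordinal iN)) //= (bigD1 (Ordinal jN)) //=.
  by rewrite -val_eqE /= eq_sym.
rewrite !E Ai (negbTE Aj) /jump /upd !eqxx (negbTE ij) /= ?muln1 ?muln0.
rewrite (eq_bigr (fun q : 'I_N => g q * A q)%N); first by lia.
move=> q /andP[]; rewrite -!val_eqE /= => /negbTE -> /negbTE ->.
by [].
Qed.
End Weight.

Section Valid.
Variables (n m : nat).
Hypothesis hm : (m <= n)%N.

Definition valid (A : config) :=
  [/\ A 0%N, forall p, (n < p)%N -> ~~ A p & weight n.+1 (fun=> 1%N) A = m.+1].

Lemma cnt_weight A p : cnt A p = weight p (fun=> 1%N) A.
Proof. by apply: eq_bigr => q _; rewrite mul1n. Qed.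

Lemma valid_config0 : valid (config0 m).
Proof.
split=> // [p|]; first by rewrite /config0; lia.
by rewrite -cnt_weight cnt_config0; lia.
Qed.

Lemma valid_jump (A : config) i j : (0 < i <= n)%N -> (0 < j <= n)%N -> A i -> ~~ A j ->
  valid A -> valid (jump A i j).
Proof.
move=> /andP[i0 iN] /andP[j0 jN] Ai Aj [A0 An Am]; split=> [|p pn|].
- by rewrite /jump /upd !ltn_eqF.
- by rewrite /jump /upd !gtn_eqF ?An //; lia.
have := @weight_jump n.+1 (fun=> 1%N) A i j; rewrite Am !ltnS.
by move=> /(_ iN jN Ai Aj); lia.
Qed.

Lemma valid_up (A : config) p : (0 < p < n)%N -> A p -> ~~ A p.+1 ->
  valid A -> valid (swapc A p).
Proof.
move=> pn Ap Ap1 vA; rewrite -jump_up //; last exact/negbTE.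
by apply: valid_jump => //; lia.
Qed.

Lemma valid_down (A : config) p : (0 < p < n)%N -> ~~ A p -> A p.+1 ->
  valid A -> valid (swapc A p).
Proof.
move=> pn Ap Ap1 vA; rewrite -jump_down //; last exact/negbTE.
by apply: valid_jump => //; lia.
Qed.

Lemma no_descent A : valid A ->
  (forall p, (0 < p < n)%N -> A p.+1 -> A p) -> A = (config0 m).
Proof.
move=> [A0 An Am] dA; pose P p := ~~ A p.
have exP : exists p, P p by exists n.+1; apply: An.
(* [k] is the first empty position. Emptiness propagates upwards from it, so the occupied positions
   are those below [k], and counting them forces k = m + 1. *)
case: (ex_minnP exP) => k Pk mink.
have AE p : A p = (p < k)%N.
  case: ltnP => [pk|kp]; first by apply: contraTT pk => /mink; rewrite -leqNgt.
  elim: p kp => [|p IH]; first by rewrite leqn0 => /eqP k0; move: Pk; rewrite /P k0 A0.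
  rewrite leq_eqVlt => /predU1P[<-|kp]; first exact/negbTE.
  apply/negbTE; apply/negP => Ap1.
  have pn : (p.+1 <= n)%N by rewrite leqNgt; apply/negP => /An; rewrite Ap1.
  have p0 : (0 < p)%N.
    rewrite lt0n; apply/eqP => p0; move: Pk; have -> : k = 0%N by lia.
    by rewrite /P A0.
  by move/IH: kp; rewrite dA // p0.
have k0 : (0 < k)%N by rewrite -AE.
have kn : (k <= n.+1)%N by apply/mink/An.
have EA : A = config0 k.-1.
  by apply/funext => p; rewrite AE /config0; apply/idP/idP; lia.
by move: Am; rewrite EA -cnt_weight cnt_config0 => km; congr config0; lia.
Qed.

End Valid.

Section SameResidues.
Variables (F : fieldType) (e n : nat) (kappa1 kappa2 : 'Z_e) (m : nat).
Hypotheses (he : (3 <= e)%N) (hm : (m <= n)%N).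
Hypothesis hn : n%:R <> kappa2 - kappa1 + 1.
Local Notation T := (ptype_at kappa1 kappa2).
Local Notation res := (residue kappa1 kappa2).
Local Notation resof := (residues_of n kappa1 kappa2).
Local Notation valid := (valid n m).

Lemma std_valid (M : lmodType (klr F e n)) (z : M) k A s : std m z k A s -> valid A.
Proof.
elim=> [|{}k {}A {}s r _ IH A1 A2]; first exact: valid_config0 hm.
by apply: (valid_up hm) => //; have := ltn_ord r; lia.
Qed.

Lemma residue_eq_tz (A B : config) p :
  cnt A p = cnt B p -> A p -> ~~ B p -> res A p = res B p -> is_tz (T p).
Proof.
move=> cAB Ap /negbTE Bp; rewrite /residue cAB Ap Bp => /addIr E.
by rewrite is_tzE // eq_sym -subr_eq0 -(subrr (kappa2 + 1)) {2}E; apply/eqP; ring.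
Qed.

(* Two configurations with the same residues first differ in two adjacent
   positions, which carry equal residues; the hypothesis on [n] ensures that
   the second of them exists. *)
Lemma same_residues A B : valid A -> valid B -> resof A = resof B -> A <> B ->
  exists p, [/\ (0 < p < n)%N, is_tz (T p) &
    [&& A p, ~~ A p.+1, ~~ B p & B p.+1] ||
    [&& B p, ~~ B p.+1, ~~ A p & A p.+1]].
Proof.
move=> vA vB AB nAB; pose P p := A p != B p.
have exP : exists p, P p.
  apply: contrapT => nP; apply: nAB; apply/funext => p; apply/eqP/negPn/negP => Pp.
  by apply: nP; exists p.
case: (ex_minnP exP) => p Pp minp.
have cp q : (q <= p)%N -> cnt A q = cnt B q.
  move=> qp; apply: eq_bigr => i _; congr nat_of_bool; apply/eqP/negPn/negP => /minp.
  by have := ltn_ord i; lia.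
have p0 : (0 < p)%N.
  by rewrite lt0n; apply: contraNneq Pp => ->; case: vA vB => -> _ _ [-> _ _].
have pn : (p <= n)%N.
  rewrite leqNgt; apply: contraNN Pp => pn.
  by case: vA vB => _ /(_ p pn)/negbTE -> _ [_ /(_ p pn)/negbTE -> _].
have resE q : (0 < q <= n)%N -> res A q = res B q.
  case: q => // q qn; have /ffunP/(_ (Ordinal qn)) := AB; by rewrite !ffunE.
have tz : is_tz (T p).
  case Ap : (A p); move: Pp; rewrite /P Ap; case Bp : (B p) => // _.
    by apply: (@residue_eq_tz A B); rewrite ?Ap ?Bp ?cp // resE ?p0.
  by apply: (@residue_eq_tz B A); rewrite ?Ap ?Bp ?cp // resE ?p0.
have pn' : (p < n)%N.
  rewrite ltn_neqAle pn andbT; apply/eqP => E; apply: hn.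
  by move: tz; rewrite is_tzE // E => /eqP.
exists p; split; rewrite ?p0 //.
(* The residues at p + 1 agree as well. Unless [A] and [B] have exchanged values at p and p + 1,
   they would differ there by 1 or 2 up to sign. *)
have := resE p.+1 pn'; rewrite /residue !cntS (cp p) //.
have := tz; rewrite is_tzE // => /eqP pc; rewrite -natr1 pc !natrD.
have n1 := Ze_neq0 he (isT : (0 < 1 < 3)%N); have n2 := Ze_neq0 he (isT : (0 < 2 < 3)%N).
move: Pp; rewrite /P; case: (A p); case: (B p) => // _;
  case: (A p.+1); case: (B p.+1) => //= /eqP; rewrite -subr_eq0 => /eqP E.
- by case/eqP: n1; rewrite -oppr0 -E; ring.
- by case/eqP: n2; rewrite -oppr0 -E; ring.
- by case/eqP: n1; rewrite -oppr0 -E; ring.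
- by case/eqP: n1; rewrite -E; ring.
- by case/eqP: n2; rewrite -E; ring.
- by case/eqP: n1; rewrite -E; ring.
Qed.
End SameResidues.

(** * Reaching the generator from a nonzero vector *)

Section Attains.
Variables (F : fieldType) (e n : nat) (kappa1 kappa2 : 'Z_e) (m : nat).
Hypotheses (he : (3 <= e)%N) (hm : (m <= n)%N).
Hypotheses (hkappa : kappa2 <> kappa1 - 1) (hn : n%:R <> kappa2 - kappa1 + 1).
Local Notation T := (ptype_at kappa1 kappa2).
Local Notation V := {malg F[config]}.
Local Notation psi := (psi_op F T).
Local Notation y := (y_op F T).
Local Notation resof := (residues_of n kappa1 kappa2).
Local Notation e_op := (@e_op F e n kappa1 kappa2).
Local Notation fock := (@fock F e n kappa1 kappa2).
Local Notation valid := (valid n m).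

Definition attains (v w : V) := exists x, fock x v = w.

Lemma attains_trans u v w : attains u v -> attains v w -> attains u w.
Proof. by move=> [x <-] [x' <-]; exists (x' * x); rewrite fockM. Qed.

Lemma attainsZ a v : attains v (a *: v).
Proof. by exists a%:MP; rewrite fock_C. Qed.

Lemma attains_sign s v w : attains v ((-1) ^+ s *: w) -> attains v w.
Proof.
move=> vw; apply: attains_trans vw _; have := attainsZ ((-1) ^+ s) ((-1) ^+ s *: w).
by rewrite scalerA -expr2 sqrr_sign scale1r.
Qed.

Lemma attains_psi k v : (k.+1 < n)%N -> attains v (psi k v).
Proof.
move=> kn; have kn' : (k < n.-1)%N by lia.
by exists (fpsi F e (Ordinal kn')); rewrite fock_psi.
Qed.

Lemma attains_y k v : (k < n)%N -> attains v (y k v).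
Proof. by move=> kn; exists (fy F e (Ordinal kn)); rewrite fock_y. Qed.

Lemma attains_e i v : attains v (e_op i v).
Proof. by exists (fe F i); rewrite fock_e. Qed.

Lemma attains_up k (A : config) : (k.+1 < n)%N -> A k.+1 -> ~~ A k.+2 ->
  attains << A >> << swapc A k.+1 >>.
Proof.
move=> kn A1 A2; have := attains_psi << A >> kn.
rewrite psi_opU /psi_vec /psi_move A1 A2 /= scale1r addn1 addn2.
by rewrite jump_up //; apply/negbTE.
Qed.

Lemma not_tz0 : is_tz (T 0) = false.
Proof.
rewrite is_tzE //; apply/eqP => /esym/eqP; rewrite addrAC subr_eq0 => /eqP E.
by apply: hkappa; rewrite -E addrK.
Qed.

Lemma not_tzn : is_tz (T n) = false.
Proof. by rewrite is_tzE //; apply/eqP. Qed.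

(* When [psi_p] or [y_p] alone does not lower the entry at [p + 1], it is first
   moved out of the way of its neighbour. *)
Lemma step_down (A : config) p : valid A -> (0 < p < n)%N -> ~~ A p -> A p.+1 ->
  exists i j, [/\ (0 < j)%N, (j < i <= n)%N, A i, ~~ A j &
    attains << A >> << jump A i j >>].
Proof.
case: p => // k vA /= kn A1 A2.
have up := attains_psi << A >> kn; have := up.
rewrite psi_opU /psi_vec /psi_move (negbTE A1) A2 /=.
have tz1 := is_tp_succ kappa1 kappa2 he k.
have tz2 := is_tz_succ kappa1 kappa2 he k.+1.
case Tk : (T k.+1) tz1 tz2 => /= tz1 tz2.
- move=> _; exists k.+2, k.+1; split=> //; first lia.
  have := attains_y << A >> (ltnW kn); rewrite y_opU /y_vec /y_move Tk A1 A2 /=.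
  by rewrite addn1 addn2 => /(@attains_sign 1).
(* Type [Tp] at position 1 would mean type [Tz] at 0, that is kappa2 = kappa1 - 1. *)
- have k0 : (0 < k)%N.
    by rewrite lt0n; apply/eqP => k0; move: tz1; rewrite k0 not_tz0.
  case A0 : (A k) => /= up'; last first.
    exists k.+2, k; rewrite A0; split=> //; first lia.
    by move: up'; rewrite addn0 addn2 => /(@attains_sign 1).
  exists k.+2, k.+1; split=> //; first lia.
  (* The lower entry steps up by one, then psi brings the upper entry down by two into the place
     just left; the net effect is to lower the upper entry by one. *)
  case: k k0 kn A1 A2 A0 Tk {up up' tz1 tz2} => // k _ kn A1 A2 A0 Tk.
  have := attains_up (ltnW kn) A0 A1; move/attains_trans; apply.
  have := attains_psi << swapc A k.+1 >> kn.
  rewrite psi_opU /psi_vec /psi_move Tk swapc_r A0 swapc_l (negbTE A1).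
  rewrite swapc_id ?A2 /= ?scale1r ?addn0 ?addn2; try lia.
  by rewrite -jump_up ?(negbTE A1) // -jump_past //; lia.
(* Type [Tm] at n - 1 would mean type [Tz] at n, against the hypothesis on n. *)
- have k2 : (k.+2 < n)%N.
    move: kn; rewrite leq_eqVlt => /predU1P[kn|//].
    by move: tz2; rewrite kn not_tzn.
  case A3 : (A k.+3) => /= up'.
    exists k.+3, k.+1; split=> //; first lia.
    by move: up'; rewrite addn1 addn3 => /(@attains_sign 0).
  exists k.+2, k.+1; split=> //; first lia.
  have := attains_up k2 A2 (negbT A3); move/attains_trans; apply.
  have := attains_psi << swapc A k.+2 >> kn.
  rewrite psi_opU /psi_vec /psi_move Tk swapc_l A3 swapc_r A2.
  rewrite !swapc_id ?(negbTE A1) /=; try lia.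
  rewrite addn1 addn3 => /(@attains_sign 1).
  by rewrite -jump_up // -jump_via //; lia.
- rewrite addn1 addn2 scale1r => ?; exists k.+2, k.+1; split=> //; lia.
Qed.

Lemma attains_config0 A : valid A -> attains << A >> << config0 m >>.
Proof.
have [k] := ubnP (weight n.+1 id A); elim: k A => // k IH A Ak vA.
have [[p [pn Ap Ap1]]|nd] :=
    pselect (exists p, [/\ (0 < p < n)%N, ~~ A p & A p.+1]); last first.
  suff -> : A = config0 m by exists 1; rewrite fock1.
  apply: (no_descent hm vA) => p pn Ap1; apply/negPn/negP => Ap.
  by apply: nd; exists p.
have [i [j [j0 /andP[ji iN] Ai Aj]]] := step_down vA pn Ap Ap1.
move/attains_trans; apply; apply: IH; last by apply: (valid_jump hm) => //; lia.
have := @weight_jump n.+1 id A i j; rewrite !ltnS /=.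
by move=> /(_ iN (ltnW (leq_trans ji iN)) Ai Aj); lia.
Qed.

Lemma e_op_coef i w C : (e_op i w)@_C = if resof C == i then w@_C else 0.
Proof.
elim/malg_ind: w => [|a D w IH]; first by rewrite linear0 mcoeff0 if_same.
rewrite linearP !mcoeffD {}IH !mcoeffZ e_opU.
case: (eqVneq D C) => [->|DC].
  by case: ifP => _; rewrite ?mcoeff0 ?mulr0 ?addr0.
rewrite [(<< D >>)@__]mcoeffU (negbTE DC) mulr0 add0r.
by case: ifP => _; rewrite ?mcoeff0 ?mcoeffU ?(negbTE DC) ?mulr0 add0r.
Qed.

(** Two consecutive positions are never both of type [Tz], so only the first rule of [y_move]
    applies. It is injective on the basis vectors that it does not kill, so no coefficients are
    added up. *)
Lemma y_op_coef k w C : is_tz (T k.+1) ->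
  (y k w)@_C = if C k.+1 && ~~ C k.+2 then - w@_(swapc C k.+1) else 0.
Proof.
move=> tz1; have tz0 : is_tz (T k) = false.
  by rewrite -is_tp_succ //; case: (T k.+1) tz1.
elim/malg_ind: w => [|a D w IH]; first by rewrite linear0 !mcoeff0 oppr0 if_same.
rewrite linearP !mcoeffD {}IH !mcoeffZ y_opU /y_vec /y_move tz0 tz1 /=.
have [DC|DC] := eqVneq D (swapc C k.+1).
  rewrite {D}DC swapc_l swapc_r [~~ _ && _]andbC; case: ifP => [/andP[C1 C2]|_] /=.
    rewrite addn1 addn2 jump_down ?swapc_l ?swapc_r //; last exact/negbTE.
    by rewrite swapcK !mcoeffZ !mcoeffU !eqxx expr1 mulN1r mulrN opprD.
  by rewrite mcoeff0 mulr0 addr0.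
rewrite [(<< D >>)@_(swapc _ _)]mcoeffU (negbTE DC) mulr0 add0r.
set x := (if _ then Some _ else None); suff -> : (move_vec F D k x)@_C = 0.
  by rewrite mulr0 add0r.
rewrite /x; case: ifP => [/andP[/negbTE D1 D2]|_] /=; last exact: mcoeff0.
rewrite addn1 addn2 jump_down // mcoeffZ mcoeffU.
case: eqP => [E|_]; last by rewrite mulr0.
by case/eqP: DC; rewrite -E swapcK.
Qed.

(* A vector attained from [w] with smallest support is a multiple of a basis
   vector: two basis vectors are separated by some [e(i)], or else by the [y] of
   the first position where they differ. *)
Lemma attains_of_valid w : w != 0 -> (forall A, A \in msupp w -> valid A) ->
  attains w << config0 m >>.
Proof.
have [k] := ubnP #|` msupp w|; elim: k w => // k IH w wk w0 vw.
have [A Aw] : exists A, A \in msupp w.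
  apply: contrapT => nA; case/eqP: w0; apply/malgP => C; rewrite mcoeff0.
  by apply: mcoeff_outdom; apply/negP => Cw; apply: nA; exists C.
have [[B Bw AB]|single] := pselect (exists2 B, B \in msupp w & A <> B); last first.
  have wA : w = w@_A *: << A >>.
    apply/malgP => C; rewrite mcoeffZ mcoeffU; case: eqP => [<-|AC].
      by rewrite mulr1.
    rewrite mulr0; apply: mcoeff_outdom; apply/negP => Cw.
    by apply: single; exists C.
  rewrite wA; apply: attains_trans (attainsZ (w@_A)^-1 _) _.
  rewrite scalerA mulVf ?scale1r ?mcoeff_neq0 //.
  exact/attains_config0/vw.
have subset_lt (s : {fset config}) C : (s `<=` msupp w `\ C)%fset -> C \in msupp w ->
    (#|` s| < k)%N.
  move=> /fsubset_leq_card sw Cw; apply: leq_ltn_trans sw _.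
  by move: wk; rewrite (cardfsD1 C) Cw ltnS.
have [AB'|AB'] := eqVneq (resof A) (resof B).
  have [p [pn tz]] := same_residues he hm hn (vw A Aw) (vw B Bw) AB' AB.
  wlog /and4P[Ap Ap1 Bp Bp1] : A B Aw Bw AB {AB'} / [&& A p, ~~ A p.+1, ~~ B p & B p.+1].
    by move=> wl /orP[H|H]; [apply: (wl A B) | apply: (wl B A)] => //;
      rewrite ?H //; apply/nesym.
  move=> _; case: p pn tz Ap Ap1 Bp Bp1 => // p pn tz Ap Ap1 Bp Bp1.
  apply: attains_trans (attains_y w (k := p) _) _; first lia.
  have yw C : C \in msupp (y p w) ->
      [/\ C p.+1, ~~ C p.+2 & swapc C p.+1 \in msupp w].
    rewrite -mcoeff_neq0 y_op_coef //; case: ifP; last by rewrite eqxx.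
    by case/andP=> ? ?; rewrite oppr_eq0 mcoeff_neq0.
  (* Exchanging p + 1 and p + 2 maps the support of [y p w] injectively into that of [w], and misses
     [A], whose entry sits at p + 1. The vector [B] contributes a nonzero coefficient. *)
  apply: IH.
  - have inj : injective (fun C : config => swapc C p.+1).
      exact: (can_inj (swapcK p.+1)).
    have <- : #|` [fset swapc C p.+1 | C in msupp (y p w)]%fset| = #|` msupp (y p w)|.
      by rewrite card_imfset.
    apply: (subset_lt _ A) => //; apply/fsubsetP => D /imfsetP[/= C /yw[C1 C2 Cw] ->].
    rewrite in_fsetD1 Cw andbT; apply: contraTneq Ap => <-.
    by rewrite swapc_l.
  - apply/eqP => yw0; have := y_op_coef w (swapc B p.+1) tz.
    rewrite yw0 mcoeff0 swapc_l swapc_r swapcK Bp Bp1 /= => /eqP.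
    by rewrite eq_sym oppr_eq0 -[_ == 0]negbK mcoeff_neq0 Bw.
  - move=> C /yw[C1 C2 Cw]; rewrite -[C](swapcK p.+1).
    by apply: (valid_down hm); rewrite ?swapc_l ?swapc_r //; exact: vw.
apply: attains_trans (attains_e (resof A) w) _.
have ew C : C \in msupp (e_op (resof A) w) -> resof C = resof A /\ C \in msupp w.
  rewrite -mcoeff_neq0 e_op_coef.
  case: (eqVneq (resof C)) => [-> |_]; last by rewrite eqxx.
  by rewrite mcoeff_neq0.
apply: IH.
- apply: (subset_lt _ B) => //; apply/fsubsetP => C /ew[CA Cw].
  by rewrite in_fsetD1 Cw andbT; apply: contraNneq AB' => <-; rewrite CA.
- apply/eqP => ew0; have := e_op_coef (resof A) w A.
  by rewrite ew0 mcoeff0 eqxx => /esym/eqP; rewrite -[_ == 0]negbK mcoeff_neq0 Aw.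
- by move=> C /ew[_ /vw].
Qed.
End Attains.

(** * The cyclotomic relations and irreducibility *)

Section Irreducibility.
Variables (F : fieldType) (e n : nat) (kappa1 kappa2 : 'Z_e) (m : nat).
Hypotheses (he : (3 <= e)%N) (hm : (m <= n)%N).
Hypotheses (hkappa : kappa2 <> kappa1 - 1) (hn : n%:R <> kappa2 - kappa1 + 1).
Local Notation klr := (klr F e n).
Local Notation T := (ptype_at kappa1 kappa2).
Local Notation V := {malg F[config]}.
Local Notation y := (y_op F T).
Local Notation fock := (@fock F e n kappa1 kappa2).
Local Notation kfock := (@kfock F e n kappa1 kappa2).
Local Notation S := (specht F n kappa1 kappa2 m).
Local Notation spfock := (@specht_fock F e n kappa1 kappa2 m).
Local Notation z := (@specht_gen F e n kappa1 kappa2 m).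

Lemma fock_supp x (w : V) :
  (forall A, A \in msupp w -> fock x << A >> = 0) -> fock x w = 0.
Proof.
move=> H; rewrite (monalgE w) big_seq.
apply: (big_ind (fun v => fock x v = 0)) => [|u v uE vE|A /H xA].
- exact: fock_0r.
- by rewrite fock_Dr uE vE addr0.
have -> : << w@_A *g A >> = w@_A *: << A >> :> V.
  by apply/malgP => C; rewrite mcoeffZ !mcoeffU mulr_natr.
by rewrite fock_Zr xA scaler0.
Qed.

Lemma y_first (A : config) : A 0%N ->
  y 0 << A >> = if [&& is_tz (T 1), ~~ A 1%N & A 2%N] then - << swapc A 1 >> else 0.
Proof.
move=> A0; rewrite y_opU /y_vec /y_move A0 !andbF; case: ifP => //= /and3P[_ A1 A2].
by rewrite expr1 scaleN1r jump_down // (negbTE A1).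
Qed.

Lemma y_first2 (A : config) : A 0%N -> y 0 (y 0 << A >>) = 0.
Proof.
move=> A0; rewrite y_first //; case: ifP => [/and3P[_ A1 A2]|_]; last exact: linear0.
by rewrite linearN /= y_first ?swapc_l ?A2 ?andbF ?oppr0 // swapc_id.
Qed.

(** The first residue is kappa2 or kappa1. If these differ, the exponent is 1 and y_1 is zero,
    because position 1 has type [Tz] only when kappa1 = kappa2. If they agree, the exponent is 2;
    after one move position 1 is occupied, and the occupied dummy blocks any further move. *)
Lemma cyclotomic_fock x A : cyclotomic_relator F n kappa1 kappa2 x ->
  valid n m A -> kfock x << A >> = 0.
Proof.
case=> r i r0 [A0 _ _]; rewrite kfock_mul // [kfock (ke _ _) _]kfock_pi // fock_e e_opU.
case: eqP => [Ai|_]; last exact: kfock_0r.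
have yE v : kfock (ky F e r) v = y 0 v by rewrite kfock_pi // fock_y r0.
have ir : i r = if A 1%N then kappa2 else kappa1.
  rewrite -Ai ffunE r0 /residue cntS /cnt big_ord0 A0 add0n.
  by case: (A 1%N); rewrite addrK.
have [E|/eqP E] := eqVneq kappa1 kappa2.
  have -> : kappa_mult kappa1 kappa2 (i r) = 2.
    by rewrite /kappa_mult ir E; case: ifP; rewrite eqxx.
  by rewrite expr2 kfock_mul // !yE y_first2.
have -> : kappa_mult kappa1 kappa2 (i r) = 1%N.
  rewrite /kappa_mult ir; case: ifP => _; rewrite eqxx.
    by rewrite (introF eqP E).
  by rewrite eq_sym (introF eqP E).
rewrite expr1 yE y_first // is_tzE // (_ : (_ == _) = false) //.
apply/eqP => E'; apply: E; apply/esym/subr0_eq.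
by apply: (addIr 1); rewrite add0r -E'.
Qed.

Lemma specht_cyclotomic :
  annihilated (cyclotomic_relator F n kappa1 kappa2) (specht F n kappa1 kappa2 m).
Proof.
move=> x rx v; apply: (@specht_fock_inj F e n kappa1 kappa2 m he hm).
apply: etrans (specht_fockZ he hm x v) _.
apply: etrans _ (esym (specht_fock0 F kappa1 kappa2 he hm)); apply: fock_supp => A Av.
have [s [k sA]] := proj2 (specht_basis he hm v) A Av.
exact: cyclotomic_fock rx (std_valid he hm sA).
Qed.

Lemma specht_attains (u : S) : u <> 0 -> exists x : klr, x *: u = z.
Proof.
move=> u0; have := @attains_of_valid F e n kappa1 kappa2 m he hm hkappa hn.
move=> /(_ (spfock u)) [||x xu].
- apply/eqP => fu0; apply: u0; apply: (@specht_fock_inj F e n kappa1 kappa2 m he hm).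
  by rewrite fu0 specht_fock0.
- move=> A Au; have [s [k sA]] := proj2 (specht_basis he hm u) A Au.
  exact: (std_valid he hm sA).
exists (ring_pi (@klr_relator F e n) x).
apply: (@specht_fock_inj F e n kappa1 kappa2 m he hm).
apply: etrans (specht_fockZ he hm _ u) _; apply: etrans (kfock_pi _ _ he x _) _.
by rewrite xu (specht_fock_std he hm (Std0 _ _)).
Qed.

Lemma specht_gen_neq0 : z <> 0.
Proof.
move=> z0; have := specht_fock_std he hm (Std0 m z).
rewrite z0 specht_fock0 // => /eqP; rewrite eq_sym monalgU_eq0.
by rewrite oner_eq0.
Qed.
End Irreducibility.

Lemma irreducible_cyclic (R : pzRingType) (X : R -> Prop) (M : lmodType R)
    (ann : annihilated X M) (z : M) :
  z <> 0 -> (forall v : M, exists x : R, v = x *: z) ->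
  (forall v : M, v <> 0 -> exists x : R, x *: v = z) ->
  irreducible_module (descended ann : lmodType (quot_ring X)).
Proof.
move=> z0 cyc att; split; first by exists z; apply/eqP.
move=> U [U0 Ulin].
have Uscale (x : R) (v : M) : (v : descended ann) \in U -> (x *: v : descended ann) \in U.
  move=> vU; have := Ulin (ring_pi X x) v 0 vU U0.
  by rewrite addr0 [_ *: _]descend_scaleE.
have [[v vU v0]|nU] := pselect (exists2 v, v \in U & v <> 0); [right|left] => w.
  rewrite inE; have [x xv] := att v v0; have [x' ->] := cyc w.
  by have := Uscale x v vU; rewrite xv; apply: Uscale.
rewrite !inE; apply/idP/eqP => [wU|-> //].
by apply: contrapT => w0; apply: nU; exists w.
Qed.

Theorem theorem6p8 (F : fieldType) (e n : nat) (kappa1 kappa2 : 'Z_e)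
    (he : (3 <= e)%N) (hn : (1 <= n)%N)
    (hkappa : kappa2 <> kappa1 - 1)
    (hnkappa : n%:R <> kappa2 - kappa1 + 1)
    (m : nat) (hm : (m <= n)%N) :
  exists annS : annihilated (cyclotomic_relator F n kappa1 kappa2)
                            (specht F n kappa1 kappa2 m),
    irreducible_module
      (descended annS : lmodType (cyclotomic_klr F n kappa1 kappa2)).
Proof.
exists (@specht_cyclotomic F e n kappa1 kappa2 m he hm).
apply: (@irreducible_cyclic _ _ _ _ (specht_gen F n kappa1 kappa2 m)).
- exact: specht_gen_neq0.
- exact: specht_cyclic.
- exact: specht_attains.
Qed.
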